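(* Let $(A,m)$ be an $A_\infty$-algebra and let $H_*(A)$ be the homology of the chain complex $(A,m_1)$. Given a choice of deformation retract of $(A,m_1)$ onto $(H_*(A),0)$, with chain maps $p:A\to H_*(A)$, $i:H_*(A)\to A$ and homotopy $h:A\to A$ of degree $+1$ satisfying \[ pi=\mathrm{id},\quad \mathrm{id}-ip=m_1h+hm_1,\quad h^2=0,\quad ph=0,\quad hi=0, \] let $\chi_2:=m_2$ and, for $n\ge3$, \[ \chi_n:=m_n+\sum_{j=1}^{n-2}(-1)^{n-j}\chi_{n-j}h_{n-j}m_{j+1}^n. \] Assume that $m_1'=0$ and $m_n':=p\chi_n i^{\otimes n}$ for $n\ge2$ defines an $A_\infty$-structure on $H_*(A)$. Then $p_1:=p$ and, for $n\ge2$, \[ p_n:=(-1)^n\sum_{j=1}^{n-1}p_j\,m_{n-j+1}^n\,h_n \] defines a morphism of $A_\infty$-algebras $p:(A,m)\to(H_*(A),m')$.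
   Context: Graded vector spaces are $\mathbb Z$-graded over a field $k$; tensor products of graded maps use the Koszul sign convention $(f\otimes g)(v\otimes w)=(-1)^{|g||v|}f(v)\otimes g(w)$. An $A_\infty$-algebra $(A,m)$ is a graded vector space with maps $m_n:A^{\otimes n}\to A$ of degree $n-2$, $n\ge1$, such that for all $n\ge1$: $\sum_{r+s+t=n,\ s\ge1}(-1)^{rs+t}m_{r+t+1}(\mathrm{id}^{\otimes r}\otimes m_s\otimes\mathrm{id}^{\otimes t})=0$. A morphism $f:(A,m)\to(A',m')$ of $A_\infty$-algebras is a family $f_n:A^{\otimes n}\to A'$ of degree $n-1$ with $\sum_{r+s+t=n}(-1)^{rs+t}f_{r+t+1}(\mathrm{id}^{\otimes r}\otimes m_s\otimes\mathrm{id}^{\otimes t})=\sum_{i_1+\dots+i_r=n}(-1)^{l(i_1,\dots,i_r)}m'_r(f_{i_1}\otimes\dots\otimes f_{i_r})$ for all $n\ge1$, where $l(i_1,\dots,i_r)=\sum_{1\le j<k\le r}(i_k-1)i_j$. Notation: $h_n=\sum_{r+t=n-1}\mathrm{id}^{\otimes r}\otimes h\otimes(ip)^{\otimes t}:A^{\otimes n}\to A^{\otimes n}$ for $n\ge1$; for $1\le j\le n$, $m_j^n=\sum_{r+j+t=n}(-1)^{rj+t}\,\mathrm{id}^{\otimes r}\otimes m_j\otimes\mathrm{id}^{\otimes t}:A^{\otimes n}\to A^{\otimes n-j+1}$. *)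

(* Defs.v *)
From HB Require Import structures.
From mathcomp Require Import all_boot all_order all_algebra.
From mathcomp Require Import generic_quotient ring_quotient.
From mathcomp Require Import boolp classical_sets fsbigop.
Set Implicit Arguments.
Unset Strict Implicit.
Unset Printing Implicit Defensive.
Import GRing.Theory.
Local Open Scope ring_scope.

(** A Z-graded vector space is given by its total space [V] together with the
    projections [gproj d] of a decomposition of [V] as the direct sum of its
    subspaces [V_d = {v | gproj d v = v}]. *)
Record graded (k : fieldType) := Graded {
  gspace :> lmodType k;
  gproj : int -> {linear gspace -> gspace};
  gprojK : forall d e v, gproj d (gproj e v) = if d == e then gproj d v else 0;
  gproj_sum : forall v, exists2 s : seq int,
    uniq s & v = \sum_(d <- s) gproj d v }.

Arguments gproj {k _}.

Definition homog (k : fieldType) (V : graded k) (d : int) (v : V) : Prop :=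
  gproj d v = v.

Lemma gproj_notin (k : fieldType) (V : graded k) (s : seq int) e (v : V) :
  v = \sum_(d <- s) gproj d v -> e \notin s -> gproj e v = 0.
Proof.
move=> vE es; rewrite vE linear_sum big_seq big1 // => d ds.
by rewrite gprojK; case: eqP => // ed; rewrite ed ds in es.
Qed.

(** The operator [v |-> (-1)^(d|v|) v], extended linearly to inhomogeneous [v];
    the sum has finite support by [gproj_sum]. *)
Definition koszul (k : fieldType) (V : graded k) (d : int) (v : V) : V :=
  \sum_(e \in setT) (-1) ^+ `|(d * e)%R|%N *: gproj e v.

Lemma koszulE (k : fieldType) (V : graded k) (s : seq int) d (v : V) :
  uniq s -> v = \sum_(e <- s) gproj e v ->
  koszul d v = \sum_(e <- s) (-1) ^+ `|(d * e)%R|%N *: gproj e v.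
Proof.
move=> us vE; rewrite /koszul (fsbigE s) //=.
  by rewrite big_mkcond; apply: eq_bigr => e _; rewrite in_setT.
by move=> e _ es; rewrite (gproj_notin vE es) scaler0.
Qed.

Lemma koszul0 (k : fieldType) (V : graded k) (v : V) : koszul 0 v = v.
Proof.
have [s us vE] := gproj_sum v; rewrite (koszulE _ us vE) [RHS]vE.
by apply: eq_bigr => e _; rewrite mul0r scale1r.
Qed.

Lemma koszul_homog (k : fieldType) (V : graded k) (d e : int) (v : V) :
  homog e v -> koszul d v = (-1) ^+ `|(d * e)%R|%N *: v.
Proof.
move=> ve; rewrite /koszul (@fsbigE _ _ _ _ _ [:: e]) //=.
- by rewrite big_mkcond big_seq1 in_setT ve.
- by move=> j _; rewrite inE => je /=; rewrite -ve gprojK (negbTE je) scaler0.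
Qed.

(** A linear map [V^{(x)n} -> W] is represented by the corresponding n-linear
    map, itself a function on words [seq V] of which only the values on words of
    size [n] matter. *)

Definition multilinear (k : fieldType) (V W : lmodType k) (n : nat)
    (f : seq V -> W) : Prop :=
  forall (l r : seq V) (a : k) (u v : V), (size l + size r).+1 = n ->
    f (l ++ (a *: u + v) :: r) = a *: f (l ++ u :: r) + f (l ++ v :: r).

Definition has_degree (k : fieldType) (V W : graded k) (n : nat) (d : int)
    (f : seq V -> W) : Prop :=
  forall (w : seq V) (e : seq int), size w = n -> size e = n ->
    (forall j, (j < n)%N -> homog (nth 0 e j) (nth 0 w j)) ->
    homog (\sum_(x <- e) x + d) (f w).

Definition graded_map (k : fieldType) (V W : graded k) (n : nat) (d : int)
    (f : seq V -> W) : Prop :=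
  multilinear n f /\ has_degree n d f.

(** A tensor factor: a map [fn : V^{(x)ar} -> W] of degree [dg]. *)
Record factor (V W : Type) := Factor {
  ar : nat;
  dg : int;
  fn : seq V -> W }.

(** [tensor [:: f_1; ...; f_r] w] is the word
    [(f_1 (x) (f_2 (x) ... (x) f_r)) w] with the Koszul sign rule
    [(f (x) g)(v (x) w) = (-1)^(|g||v|) f v (x) g w]. *)
Fixpoint tensor (k : fieldType) (V : graded k) (W : Type)
    (fs : seq (factor V W)) (w : seq V) : seq W :=
  if fs is f :: gs then
    fn f (map (koszul (\sum_(g <- gs) dg g)) (take (ar f) w))
      :: tensor gs (drop (ar f) w)
  else [::].

Definition unary (k : fieldType) (V W : lmodType k) (d : int) (f : V -> W) :
  factor V W := Factor 1 d (fun w => f (head 0 w)).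

Definition fid (k : fieldType) (V : lmodType k) : factor V V := unary 0 idfun.

Arguments fid {k V}.

Section Ainf.
Variables (k : fieldType) (V : graded k).

Definition mfac (m : nat -> seq V -> V) (s : nat) : factor V V :=
  Factor s (s%:Z - 2) (m s).

(** [phi \o m_j^n], for [phi : V^{(x)(n-j+1)} -> W] and [1 <= j <= n], where
    [m_j^n = \sum_(r+j+t=n) (-1)^(rj+t) id^{(x)r} (x) m_j (x) id^{(x)t}]. *)
Definition comp_m (m : nat -> seq V -> V) (j n : nat) (W : lmodType k)
    (phi : seq V -> W) : seq V -> W := fun w =>
  \sum_(0 <= r < (n - j).+1) let t := (n - j - r)%N in
    (-1) ^+ (r * j + t) *:
      phi (tensor (nseq r fid ++ mfac m j :: nseq t fid) w).

Definition is_ainf (m : nat -> seq V -> V) : Prop :=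
  (forall n, (1 <= n)%N -> graded_map n (n%:Z - 2) (m n)) /\
  (forall n (w : seq V), (1 <= n)%N -> size w = n ->
    \sum_(1 <= s < n.+1) comp_m m s n (m (n - s).+1) w = 0).

End Ainf.

Record ainf (k : fieldType) := Ainf {
  aspace :> graded k;
  aop : nat -> seq aspace -> aspace;
  aopP : is_ainf aop }.

Arguments aop {k} _ _ _.
Arguments Ainf {k aspace aop} aopP.

(** [l(i_1, ..., i_r) = \sum_(j < k) (i_k - 1) i_j]; all [i_k] are positive. *)
Definition lsign (c : seq nat) : nat :=
  (\sum_(0 <= b < size c) \sum_(0 <= a < b) (nth 0 c b).-1 * nth 0 c a)%N.

(** In the right-hand side [c] ranges over the compositions [(i_1, ..., i_r)]
    of [n] into [r] positive parts. *)
Definition is_ainf_morphism (k : fieldType) (A B : ainf k)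
    (f : nat -> seq A -> B) : Prop :=
  (forall n, (1 <= n)%N -> graded_map n (n%:Z - 1) (f n)) /\
  (forall n (w : seq A), (1 <= n)%N -> size w = n ->
    \sum_(1 <= s < n.+1) comp_m (aop A) s n (f (n - s).+1) w =
    \sum_(1 <= r < n.+1)
      \sum_(c : r.-tuple 'I_n.+1 |
              all (fun x : 'I_n.+1 => 0 < x)%N c &&
              (\sum_(x <- c) (x : nat) == n)%N)
        (-1) ^+ lsign (map val c) *:
          aop B r (tensor [seq Factor (val x) ((val x)%:Z - 1) (f (val x))
                          | x <- c] w)).

Record complex (k : fieldType) := Complex {
  cspace :> graded k;
  diff : {linear cspace -> cspace};
  diff_deg : forall d v, homog d v -> homog (d - 1) (diff v);
  diffK : forall v, diff (diff v) = 0 }.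

Arguments diff {k} _.

Lemma gproj_diff (k : fieldType) (C : complex k) d (v : C) :
  gproj d (diff C v) = diff C (gproj (d + 1) v).
Proof.
have [s us vE] := gproj_sum v; rewrite {1}vE !linear_sum /=.
have E e : gproj d (diff C (gproj e v)) =
    if e == d + 1 then diff C (gproj e v) else 0.
  have h : homog (e - 1) (diff C (gproj e v)).
    by apply: diff_deg; rewrite /homog gprojK eqxx.
  rewrite -{1}h gprojK; have -> : (d == e - 1) = (e == d + 1).
    by rewrite eq_sym subr_eq.
  by case: eqP => // eE; move: h; rewrite eE addrK.
rewrite (eq_bigr _ (fun e _ => E e)) -big_mkcond /= -big_filter.
have [sd|sd] := boolP (d + 1 \in s); first by rewrite filter_pred1_uniq ?big_seq1.
rewrite (gproj_notin vE sd) raddf0 big_filter big_seq_cond big1 // => e.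
by case/andP=> es /eqP ee; rewrite -ee es in sd.
Qed.

Section Homology.
Variables (k : fieldType) (C : complex k).

Definition is_cycle : {pred C} := fun v => diff C v == 0.

Fact is_cycle_submod : submod_closed is_cycle.
Proof.
split; first by rewrite unfold_in raddf0.
move=> a u v; rewrite !unfold_in => /eqP u0 /eqP v0.
by rewrite linearP u0 v0 scaler0 addr0.
Qed.

HB.instance Definition _ := GRing.isSubmodClosed.Build k C is_cycle
  is_cycle_submod.

Record cycles := Cycle { cycle_val : C; cycle_valP : cycle_val \in is_cycle }.

HB.instance Definition _ := [isSub for cycle_val].
HB.instance Definition _ := [Choice of cycles by <:].
HB.instance Definition _ := [SubChoice_isSubLmodule of cycles by <:].

Definition is_boundary : {pred cycles} :=
  fun z => `[< exists v : C, val z = diff C v >].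

Fact is_boundary_zmod : zmod_closed is_boundary.
Proof.
split; first by apply/asboolP; exists 0; rewrite !raddf0.
move=> u v /asboolP[x ux] /asboolP[y vy]; apply/asboolP; exists (x - y).
by rewrite !raddfB /= ux vy.
Qed.

HB.instance Definition _ := GRing.isZmodClosed.Build cycles is_boundary
  is_boundary_zmod.

Definition hspace : Type := {ideal_quot is_boundary}.
HB.instance Definition _ := GRing.Zmodule.on hspace.

Definition hclass (z : cycles) : hspace := (\pi_({ideal_quot is_boundary}) z)%qT.

Lemma hclass_eq (y z : cycles) :
  hclass y = hclass z <-> exists v : C, val y - val z = diff C v.
Proof.
rewrite -[_ - _](raddfB (val : cycles -> C)); split=> [/eqP|yz].
  by rewrite -Quotient.idealrBE => /asboolP.
by apply/eqP; rewrite -Quotient.idealrBE; apply/asboolP.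
Qed.

Lemma hclass_surj (x : hspace) : exists z, x = hclass z.
Proof. by exists (repr x); rewrite /hclass reprK. Qed.

Fact hclassD : {morph hclass : x y / x + y}.
Proof. by move=> x y; rewrite /hclass raddfD. Qed.

Fact hclass0 : hclass 0 = 0.
Proof. by rewrite /hclass raddf0. Qed.

Definition hscale (a : k) (x : hspace) : hspace := hclass (a *: repr x).

Fact hscaleE a z : hscale a (hclass z) = hclass (a *: z).
Proof.
apply/hclass_eq; have /hclass_eq[v vE] : hclass (repr (hclass z)) = hclass z.
  by rewrite /hclass reprK.
by exists (a *: v); rewrite [RHS]linearZ /= -vE scalerBr.
Qed.

Fact hscaleA a b x : hscale a (hscale b x) = hscale (a * b) x.
Proof. by have [z ->] := hclass_surj x; rewrite !hscaleE scalerA. Qed.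

Fact hscale1 : left_id 1 hscale.
Proof. by move=> x; have [z ->] := hclass_surj x; rewrite hscaleE scale1r. Qed.

Fact hscaleDr : right_distributive hscale +%R.
Proof.
move=> a x y; have [z ->] := hclass_surj x; have [t ->] := hclass_surj y.
by rewrite -hclassD !hscaleE scalerDr hclassD.
Qed.

Fact hscaleDl x : {morph hscale^~ x : a b / a + b}.
Proof.
by move=> a b; have [z ->] := hclass_surj x; rewrite !hscaleE scalerDl hclassD.
Qed.

HB.instance Definition _ := GRing.Zmodule_isLmodule.Build k hspace
  hscaleA hscale1 hscaleDr hscaleDl.

Lemma hclassZ a z : hclass (a *: z) = a *: hclass z.
Proof. by rewrite -hscaleE. Qed.

Fact gproj_cycle_subproof d (z : cycles) : gproj d (val z) \in is_cycle.
Proof.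
case: z => v /eqP v0 /=.
by rewrite unfold_in -[d](subrK 1) -gproj_diff v0 raddf0.
Qed.

Definition gproj_cycle d (z : cycles) : cycles :=
  Cycle (gproj_cycle_subproof d z).

Definition hproj (d : int) (x : hspace) : hspace :=
  hclass (gproj_cycle d (repr x)).

Fact hprojE d z : hproj d (hclass z) = hclass (gproj_cycle d z).
Proof.
apply/hclass_eq; have /hclass_eq[v vE] : hclass (repr (hclass z)) = hclass z.
  by rewrite /hclass reprK.
by exists (gproj (d + 1) v); rewrite -gproj_diff -vE raddfB.
Qed.

Fact hproj_linear d : linear (hproj d).
Proof.
move=> a x y; have [z ->] := hclass_surj x; have [t ->] := hclass_surj y.
rewrite -hclassZ -hclassD !hprojE -hclassZ -hclassD; congr hclass.
by apply: val_inj; rewrite /= !linearP.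
Qed.

HB.instance Definition _ d :=
  GRing.isLinear.Build k hspace hspace *:%R (hproj d) (hproj_linear d).

Fact hprojK d e x :
  hproj d (hproj e x) = if d == e then hproj d x else 0.
Proof.
have [z ->] := hclass_surj x; rewrite !hprojE.
have -> : gproj_cycle d (gproj_cycle e z) =
    if d == e then gproj_cycle d z else 0.
  by apply: val_inj; rewrite /= gprojK; case: eqP => // _; rewrite raddf0.
by case: eqP; rewrite ?hclass0.
Qed.

Fact hproj_sum x : exists2 s : seq int, uniq s & x = \sum_(d <- s) hproj d x.
Proof.
have [z ->] := hclass_surj x; have [s us vE] := gproj_sum (val z).
exists s => //; rewrite (eq_bigr _ (fun d _ => hprojE d z)).
rewrite -(big_morph hclass hclassD hclass0); congr hclass.
by apply: val_inj; rewrite {1}vE raddf_sum.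
Qed.

(** [H_d] consists of the classes of the cycles of degree [d]. *)
Definition homology : graded k := Graded hprojK hproj_sum.

End Homology.

Section ZeroComplex.
Variables (k : fieldType) (V : graded k).

Fact zero_diff_deg d (v : V) : homog d v -> homog (d - 1) (\0 v : V).
Proof. by move=> _; rewrite /homog raddf0. Qed.

Fact zero_diffK (v : V) : \0 (\0 v : V) = 0 :> V.
Proof. by []. Qed.

Definition zero_complex : complex k := Complex zero_diff_deg zero_diffK.

End ZeroComplex.

Section AinfComplex.
Variables (k : fieldType) (A : ainf k).

Definition m1 (v : A) : A := aop A 1 [:: v].

Fact m1_linear : linear m1.
Proof.
move=> a u v; have [mP _] := (aopP A).1 1%N isT.
exact: (mP [::] [::] a u v erefl).
Qed.

HB.instance Definition _ := GRing.isLinear.Build k A A *:%R m1 m1_linear.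

Fact m1_deg d (v : A) : homog d v -> homog (d - 1) (m1 v).
Proof.
move=> vd; have [_ /(_ [:: v] [:: d])] := (aopP A).1 1%N isT.
rewrite big_seq1; apply=> //; by case.
Qed.

Fact m1K (v : A) : m1 (m1 v) = 0.
Proof.
have := (aopP A).2 1%N [:: v] isT erefl.
rewrite big_nat1 /comp_m big_nat1 /= big_nil.
by rewrite koszul0 scale1r.
Qed.

Definition ainf_complex : complex k := Complex m1_deg m1K.

End AinfComplex.

Record deformation_retract (k : fieldType) (C D : complex k)
    (p : {linear C -> D}) (i : {linear D -> C}) (h : {linear C -> C}) : Prop :=
  DeformationRetract {
    p_deg : forall d v, homog d v -> homog d (p v);
    i_deg : forall d x, homog d x -> homog d (i x);
    h_deg : forall d v, homog d v -> homog (d + 1) (h v);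
    p_chain : forall v, p (diff C v) = diff D (p v);
    i_chain : forall x, i (diff D x) = diff C (i x);
    piK : forall x, p (i x) = x;
    ip_homotopy : forall v, v - i (p v) = diff C (h v) + h (diff C v);
    hh0 : forall v, h (h v) = 0;
    ph0 : forall v, p (h v) = 0;
    hi0 : forall x, h (i x) = 0 }.

(** Course-of-values recursion: [F n f] computes the value at [n] from the
    values [f l] for [l < n]. *)
Fixpoint below (T : Type) (x0 : T) (F : nat -> (nat -> T) -> T) (n : nat) :
    nat -> T :=
  if n is n'.+1 then
    let f := below x0 F n' in fun l => if l == n' then F n' f else f l
  else fun=> x0.

Definition cvrec (T : Type) (x0 : T) (F : nat -> (nat -> T) -> T) (n : nat) : T :=
  F n (below x0 F n).

Lemma belowE (T : Type) (x0 : T) F n l :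
  (l < n)%N -> below x0 F n l = cvrec x0 F l.
Proof.
elim: n => // n IHn; rewrite ltnS leq_eqVlt /=.
by case: (eqVneq l n) => [-> //|_ /= /IHn].
Qed.

Section Transfer.
Variables (k : fieldType) (A : ainf k) (H : graded k).
Variables (p : {linear A -> H}) (i : {linear H -> A}) (h : {linear A -> A}).

(** [phi \o h_n], where
    [h_n = \sum_(r+t=n-1) id^{(x)r} (x) h (x) (ip)^{(x)t}]. *)
Definition comp_h (n : nat) (W : lmodType k) (phi : seq A -> W) :
    seq A -> W := fun w =>
  \sum_(0 <= r < n)
    phi (tensor (nseq r fid ++
                 unary 1 h :: nseq (n - 1 - r) (unary 0 (i \o p))) w).

Definition chi : nat -> seq A -> A :=
  cvrec (fun=> 0) (fun n f =>
    if (n <= 1)%N then fun=> 0 else if n == 2 then aop A 2 else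
    fun w => aop A n w +
      \sum_(1 <= j < n.-1) (-1) ^+ (n - j) *:
        comp_m (aop A) j.+1 n (comp_h (n - j) (f (n - j)%N)) w).

Lemma chi2 : chi 2 = aop A 2.
Proof. by []. Qed.

Lemma chiE n w : (3 <= n)%N ->
  chi n w = aop A n w +
    \sum_(1 <= j < n.-1) (-1) ^+ (n - j) *:
      comp_m (aop A) j.+1 n (comp_h (n - j) (chi (n - j))) w.
Proof.
case: n => [|[|[|n]]] // _; rewrite {1}/chi /cvrec -/chi; congr (_ + _).
apply: eq_big_nat => j /andP[j1 jn].
by rewrite belowE // ltn_subrL j1.
Qed.

Definition transfer_m (n : nat) (w : seq H) : H :=
  if (n <= 1)%N then 0 else p (chi n (tensor (nseq n (unary 0 i)) w)).

Definition transfer_p : nat -> seq A -> H :=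
  cvrec (fun=> 0) (fun n f =>
    if n == 0 then fun=> 0 else if n == 1 then fun w => p (head 0 w) else
    fun w => (-1) ^+ n *:
      \sum_(1 <= j < n)
        comp_h n (comp_m (aop A) (n - j).+1 n (f j)) w).

Lemma transfer_p1 v : transfer_p 1 [:: v] = p v.
Proof. by []. Qed.

Lemma transfer_pE n w : (2 <= n)%N ->
  transfer_p n w = (-1) ^+ n *:
    \sum_(1 <= j < n) comp_h n (comp_m (aop A) (n - j).+1 n (transfer_p j)) w.
Proof.
case: n => [|[|n]] // _; rewrite {1}/transfer_p /cvrec -/transfer_p; congr (_ *: _).
by apply: eq_big_nat => j /andP[_ jn]; rewrite belowE.
Qed.

End Transfer.

(* Main.v *)
Require Import Defs.
From HB Require Import structures.
From mathcomp Require Import all_boot all_order all_algebra.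
From mathcomp Require Import ring zify.
(** Words are suspended by twisting the i-th letter of a word of length n by
    the (n - i)-th power of the sign operator of the suspension; this
    removes all signs from the A-infinity relations. On the tensor coalgebra
    of the suspension let b = d + delta be the coderivation given by m, with
    linear part d, let P and I be induced by p and i, and let H = sum id^r
    (x) h (x) (ip)^t. The recursion for p_n becomes q = p - q delta H, the
    one for chi_n becomes chi = delta - chi H delta, whence p chi = q delta
    and m' = q delta I. By the side conditions (h^2 = 0, ph = 0, hi = 0) the
    coalgebra map F with corestriction q satisfies F = P - F delta H. As in
    the homological perturbation lemma, q b (1 + delta H) = q delta I P = m'
    P = m' F (1 + delta H), and since delta strictly shortens words, 1 +
    delta H can be cancelled: q b = m' F. *)

Set Implicit Arguments.
Unset Strict Implicit.
Unset Printing Implicit Defensive.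
Import GRing.Theory.
Local Open Scope ring_scope.

(** * Deconcatenation of words *)

(* The sum of [G u v] over all splittings [w = u ++ v] with [u] nonempty. *)
Fixpoint split_sum (T : Type) (W : zmodType) (G : seq T -> seq T -> W)
    (w : seq T) : W :=
  if w is a :: w' then G [:: a] w' + split_sum (fun u => G (a :: u)) w' else 0.

Section SplitSum.
Variables (T : Type) (W : zmodType).
Implicit Types (G : seq T -> seq T -> W) (w : seq T).

Lemma split_sum_cons G a w :
  split_sum G (a :: w) = G [:: a] w + split_sum (fun u => G (a :: u)) w.
Proof. by []. Qed.

Lemma eq_split_sum G G' w :
    (forall u v, (0 < size u)%N -> u ++ v = w -> G u v = G' u v) ->
  split_sum G w = split_sum G' w.
Proof.
elim: w G G' => //= a w IHw G G' eG; congr (_ + _); first exact: eG.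
by apply: IHw => u v u0 uv; apply: eG => //=; rewrite uv.
Qed.

Lemma split_sum0 G w :
    (forall u v, (0 < size u)%N -> u ++ v = w -> G u v = 0) ->
  split_sum G w = 0.
Proof.
move=> G0; rewrite (eq_split_sum (G' := fun _ _ => 0)) //.
by elim: w {G0} => //= _ w ->; rewrite addr0.
Qed.

Lemma split_sumD G G' w :
  split_sum (fun u v => G u v + G' u v) w = split_sum G w + split_sum G' w.
Proof.
by elim: w G G' => /= [|a w IHw] G G'; rewrite ?addr0 // IHw addrACA.
Qed.

Lemma split_sumN G w : split_sum (fun u v => - G u v) w = - split_sum G w.
Proof. by elim: w G => /= [|a w IHw] G; rewrite ?oppr0 // IHw opprD. Qed.

Lemma raddf_split_sum (W' : zmodType) (L : W -> W') G w :
    L 0 = 0 -> {morph L : x y / x + y} ->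
  L (split_sum G w) = split_sum (fun u v => L (G u v)) w.
Proof. by move=> L0 LD; elim: w G => //= a w IHw G; rewrite LD IHw. Qed.

(** Coassociativity of deconcatenation: both sides run over the cuts of [w] into three words of
    which only the first must be nonempty. Since [split_sum] demands a nonempty left part, the terms
    with an empty middle word are added separately on the left. *)
Lemma split_sum_assoc (X : seq T -> seq T -> seq T -> W) w :
  split_sum (fun u v => X u [::] v + split_sum (fun v1 v2 => X u v1 v2) v) w =
  split_sum (fun u v => split_sum (fun u1 u2 => X u1 u2 v) u) w.
Proof.
elim: w X => //= a w IHw X.
have -> : split_sum (fun u v => X (a :: u) [::] v + split_sum (X (a :: u)) v) w
   = split_sum (fun u v => split_sum (fun u1 u2 => X (a :: u1) u2 v) u) w.
  exact: (IHw (fun u => X (a :: u))).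
rewrite addr0 -addrA; congr (_ + _).
by rewrite -split_sumD.
Qed.

Lemma split_sum_map (U : Type) (f : U -> T) G (w : seq U) :
  split_sum G (map f w) = split_sum (fun u v => G (map f u) (map f v)) w.
Proof. by elim: w G => //= a w IHw G; rewrite IHw. Qed.

Lemma split_sum_nat G w :
  split_sum G w = \sum_(1 <= j < (size w).+1) G (take j w) (drop j w).
Proof.
elim: w G => [|a w IHw] G /=; first by rewrite big_geq.
rewrite big_nat_recl //= take0 drop0; congr (_ + _).
by rewrite IHw big_add1.
Qed.

Lemma split_sum_full G w : (0 < size w)%N ->
    (forall u v, (0 < size u)%N -> (0 < size v)%N -> u ++ v = w -> G u v = 0) ->
  split_sum G w = G w [::].
Proof.
elim: w G => //= a [|b w] IHw G _ G0; first by rewrite /= addr0.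
rewrite G0 // add0r IHw // => u v u0 v0 uv.
by apply: G0 => //=; rewrite uv.
Qed.

End SplitSum.

(** * Functions linear in every letter *)

Section Multilinear.
Variables (k : fieldType) (V W : lmodType k).
Implicit Types (f : seq V -> W).

(** Linearity at all lengths at once makes [f] a functional on the whole tensor coalgebra, so
    lengths need not be tracked when a letter is changed. *)
Definition mlin f : Prop := forall n, multilinear n f.

Lemma mlinP f :
  (forall l r a u v, f (l ++ (a *: u + v) :: r) =
                     a *: f (l ++ u :: r) + f (l ++ v :: r)) -> mlin f.
Proof. by move=> fL n l r a u v _. Qed.

Variable f : seq V -> W.
Hypothesis fL : mlin f.

Lemma mlinE l r a u v :
  f (l ++ (a *: u + v) :: r) = a *: f (l ++ u :: r) + f (l ++ v :: r).
Proof. exact: fL. Qed.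

Lemma mlinD l r u v :
  f (l ++ (u + v) :: r) = f (l ++ u :: r) + f (l ++ v :: r).
Proof. by rewrite -[u in LHS]scale1r mlinE scale1r. Qed.

Lemma mlin0 l r : f (l ++ 0 :: r) = 0.
Proof. by apply: (addrI (f (l ++ 0 :: r))); rewrite -mlinD !addr0. Qed.

Lemma mlinZ l r a u : f (l ++ (a *: u) :: r) = a *: f (l ++ u :: r).
Proof. by rewrite -[X in X :: r]addr0 mlinE mlin0 addr0. Qed.

Lemma mlinN l r u : f (l ++ (- u) :: r) = - f (l ++ u :: r).
Proof. by rewrite -scaleN1r mlinZ scaleN1r. Qed.

Lemma mlin_cons a : mlin (fun y => f (a :: y)).
Proof. by apply: mlinP => l r c u v; rewrite -!cat_cons mlinE. Qed.

Lemma mlin_scale_pref b (u v : seq V) :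
  f (map (fun x => b *: x) u ++ v) = b ^+ size u *: f (u ++ v).
Proof.
have E l : f (l ++ map (fun x => b *: x) u ++ v) =
    b ^+ size u *: f (l ++ u ++ v).
  elim: u l => [|a u IHu] l /=; first by rewrite scale1r.
  by rewrite mlinZ -cat_rcons IHu cat_rcons scalerA exprS.
exact: (E [::]).
Qed.

End Multilinear.

Lemma mlin_split_sum (k : fieldType) (V W : lmodType k)
    (G : seq V -> seq V -> W) :
    (forall u, (0 < size u)%N -> mlin (G u)) ->
    (forall v l r a x y, G (l ++ (a *: x + y) :: r) v =
       a *: G (l ++ x :: r) v + G (l ++ y :: r) v) ->
  mlin (split_sum G).
Proof.
move=> G1 G2; apply: mlinP => l r a x y.
elim: l G G1 G2 => [|b l IHl] G G1 G2 /=.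
  rewrite (G2 _ [::] [::]) scalerDr addrACA; congr (_ + _).
  elim: r G {G1} G2 => [|b r IHr] G G2 /=; first by rewrite scaler0 addr0.
  rewrite (G2 _ [::] [:: b]) /= scalerDr addrACA; congr (_ + _).
  (* The varying letter must stay at the head for the induction on [r], so [G'] reinserts [b] right
     behind it. *)
  pose G' u v := G (head 0 u :: b :: behead u) v.
  apply: (IHr G') => v [|c l] r' a' x' y'; rewrite /G' /=.
    exact: (G2 _ [::]).
  exact: (G2 _ (c :: b :: l)).
rewrite (mlinE (G1 _ _)) // scalerDr addrACA; congr (_ + _).
apply: (IHl (fun u => G (b :: u))) => [u u0|v l' r' a' x' y'].
  exact: G1.
exact: (G2 v (b :: l')).
Qed.

(** * Coderivations and homotopies acting on functionals *)

Section Operators.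
Variables (k : fieldType) (V : lmodType k).
Variables (K : V -> V) (mu : seq V -> V) (h g : V -> V).

(* Formal sums of words are avoided by letting operators on the tensor coalgebra
   act on functionals: [coder P phi] is [phi] composed with the coderivation
   [\sum K^{(x)r} (x) mu (x) id^{(x)t}], where [mu] is only applied to blocks
   whose length satisfies [P], and [htpy phi] is [phi] composed with
   [\sum K^{(x)r} (x) h (x) g^{(x)t}]. *)
Fixpoint coder (W : lmodType k) (P : pred nat) (phi : seq V -> W) (w : seq V)
    : W :=
  if w is a :: w' then
    split_sum (fun u v => if P (size u) then phi (mu u :: v) else 0) w +
    coder P (fun y => phi (K a :: y)) w'
  else 0.

Fixpoint htpy (W : lmodType k) (phi : seq V -> W) (w : seq V) : W :=
  if w is a :: w' then
    phi (h a :: map g w') + htpy (fun y => phi (K a :: y)) w'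
  else 0.

Lemma coder_cons (W : lmodType k) P (phi : seq V -> W) a w :
  coder P phi (a :: w) =
  split_sum (fun u v => if P (size u) then phi (mu u :: v) else 0) (a :: w) +
  coder P (fun y => phi (K a :: y)) w.
Proof. by []. Qed.

Lemma htpy_cons (W : lmodType k) (phi : seq V -> W) a w :
  htpy phi (a :: w) =
  phi (h a :: map g w) + htpy (fun y => phi (K a :: y)) w.
Proof. by []. Qed.

Section Target.
Variable W : lmodType k.
Implicit Types (phi : seq V -> W) (w : seq V) (P : pred nat).

(** [coder] evaluates [phi] only at words in which a block of [j] letters has been contracted to one
    letter. Recording that length here is what later permits inductions on word length. *)
Lemma eq_coder P phi phi' w :
    (forall j y, (0 < j)%N -> P j -> (j <= size w)%N ->
       size y = (size w - j).+1 -> phi y = phi' y) ->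
  coder P phi w = coder P phi' w.
Proof.
elim: w phi phi' => // a w IHw phi phi' E; congr (_ + _).
  apply: eq_split_sum => u v u0 uv; case: ifP => // Pu.
  have sz : size (a :: w) = (size u + size v)%N by rewrite -uv size_cat.
  by apply: (E (size u)) => //; rewrite sz ?leq_addr //= addKn.
apply: IHw => j y j0 Pj jw yj; apply: (E j) => //=; first exact: leqW.
by rewrite yj subSn.
Qed.

Lemma eq_htpy phi phi' w :
  (forall y, size y = size w -> phi y = phi' y) -> htpy phi w = htpy phi' w.
Proof.
elim: w phi phi' => // a w IHw phi phi' E /=; congr (_ + _).
  by apply: E; rewrite /= size_map.
by apply: IHw => y yw; apply: E; rewrite /= yw.
Qed.

Lemma eq_coder_pred P P' phi w :
    (forall j, (0 < j)%N -> (j <= size w)%N -> P j = P' j) ->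
  coder P phi w = coder P' phi w.
Proof.
elim: w phi => // a w IHw phi E; congr (_ + _).
  apply: eq_split_sum => u v u0 uv; rewrite E //.
  by rewrite -uv size_cat leq_addr.
by apply: IHw => j j0 jw; apply: E => //; apply: leqW.
Qed.

Lemma coderD P phi phi' w :
  coder P (fun y => phi y + phi' y) w = coder P phi w + coder P phi' w.
Proof.
elim: w phi phi' => [|a w IHw] phi phi'; first by rewrite addr0.
rewrite !coder_cons IHw [RHS]addrACA -split_sumD; congr (_ + _).
by apply: eq_split_sum => u v _ _; case: ifP; rewrite ?addr0.
Qed.

Lemma htpyD phi phi' w :
  htpy (fun y => phi y + phi' y) w = htpy phi w + htpy phi' w.
Proof.
elim: w phi phi' => [|a w IHw] phi phi' /=; first by rewrite addr0.
by rewrite IHw addrACA.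
Qed.

Lemma coder_pred2 P1 P2 P phi w :
    (forall j, (0 < j)%N -> P j = P1 j (+) P2 j) ->
    (forall j, ~~ (P1 j && P2 j)) ->
  coder P phi w = coder P1 phi w + coder P2 phi w.
Proof.
move=> E D; elim: w phi => [|a w IHw] phi; first by rewrite addr0.
rewrite !coder_cons IHw [RHS]addrACA -split_sumD; congr (_ + _).
apply: eq_split_sum => u v u0 _; rewrite E //; move: (D (size u)).
by case: (P1 _); case: (P2 _); rewrite ?addr0 ?add0r.
Qed.

End Target.

(** Additivity is a plain hypothesis because [L] will be a bare function such as [fun c => blockmap
    q r (fun z => psi (c :: z)) y]. *)
Lemma raddf_coder (W W' : lmodType k) (L : W -> W') P phi w :
    L 0 = 0 -> {morph L : x y / x + y} ->
  L (coder P phi w) = coder P (L \o phi) w.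
Proof.
move=> L0 LD; elim: w phi => // a w IHw phi.
rewrite !coder_cons LD IHw raddf_split_sum //; congr (_ + _).
by apply: eq_split_sum => u v _ _; case: ifP.
Qed.

Lemma raddf_htpy (W W' : lmodType k) (L : W -> W') phi w :
    L 0 = 0 -> {morph L : x y / x + y} ->
  L (htpy phi w) = htpy (L \o phi) w.
Proof. by move=> L0 LD; elim: w phi => //= a w IHw phi; rewrite LD IHw. Qed.

Section Target2.
Variable W : lmodType k.
Implicit Types (phi : seq V -> W) (w : seq V) (P : pred nat).

Lemma coderN P phi w : coder P (fun y => - phi y) w = - coder P phi w.
Proof. by rewrite (raddf_coder _ _ _ (oppr0 W)) //; apply: opprD. Qed.

Lemma htpyN phi w : htpy (fun y => - phi y) w = - htpy phi w.
Proof. by rewrite (raddf_htpy _ _ (oppr0 W)) //; apply: opprD. Qed.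

Lemma coderZ P c phi w : coder P (fun y => c *: phi y) w = c *: coder P phi w.
Proof. by rewrite (raddf_coder (L := *:%R c)) ?scaler0 //; apply: scalerDr. Qed.

Lemma htpyZ c phi w : htpy (fun y => c *: phi y) w = c *: htpy phi w.
Proof. by rewrite (raddf_htpy (L := *:%R c)) ?scaler0 //; apply: scalerDr. Qed.

Lemma coder0 P phi w :
    (forall j y, (0 < j)%N -> P j -> (j <= size w)%N ->
       size y = (size w - j).+1 -> phi y = 0) ->
  coder P phi w = 0.
Proof.
move=> E; rewrite (eq_coder (phi' := fun y => 0 *: phi y)) ?coderZ ?scale0r //.
by move=> j y *; rewrite scale0r (E j).
Qed.

Lemma htpy0 phi w : (forall y, size y = size w -> phi y = 0) -> htpy phi w = 0.
Proof.
move=> E; rewrite (eq_htpy (phi' := fun y => 0 *: phi y)) ?htpyZ ?scale0r //.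
by move=> y yw; rewrite scale0r E.
Qed.

Lemma coder_sum P (I : Type) (r : seq I) (phi : I -> seq V -> W) w :
  coder P (fun y => \sum_(j <- r) phi j y) w = \sum_(j <- r) coder P (phi j) w.
Proof.
elim: r => [|j r IHr]; first by rewrite big_nil coder0 // => *; rewrite big_nil.
rewrite big_cons -IHr -coderD; apply: eq_coder => *.
by rewrite big_cons.
Qed.

Lemma htpy_sum (I : Type) (r : seq I) (phi : I -> seq V -> W) w :
  htpy (fun y => \sum_(j <- r) phi j y) w = \sum_(j <- r) htpy (phi j) w.
Proof.
elim: r => [|j r IHr]; first by rewrite big_nil htpy0 // => *; rewrite big_nil.
by rewrite big_cons -IHr -htpyD; apply: eq_htpy => *; rewrite big_cons.
Qed.

(** The co-Leibniz rule: the contracted block lies in the left or in the right part, and in the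
    latter case the operator passes the left part at the cost of [K]. *)
Lemma coder_split P (G : seq V -> seq V -> W) w :
  coder P (split_sum G) w =
  split_sum (fun u v => coder P (G^~ v) u + coder P (G (map K u)) v) w.
Proof.
elim: w G => // a w IHw G; rewrite coder_cons.
rewrite (eq_coder (phi' := fun y => G [:: K a] y +
            split_sum (fun u => G (K a :: u)) y)) // coderD IHw.
(* In [X u v1 v2] the leading block [u] is contracted and [v1] completes the left part;
   [split_sum_assoc] then makes [u ++ v1] the left part of a cut of the original word. *)
pose X u v1 v2 : W := if P (size u) then G (mu u :: v1) v2 else 0.
rewrite (eq_split_sum (G' := fun u v => X u [::] v + split_sum (X u) v));
  last first.
  move=> u v _ _; rewrite /X; case: ifP => // _.
  by rewrite split_sum0 ?addr0.
rewrite split_sum_assoc !split_sum_cons coder_cons [coder _ _ [::]]/= !addr0.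
rewrite -!addrA; congr (_ + _).
rewrite add0r addrCA -split_sumD; congr (_ + _).
by apply: eq_split_sum => u v _ _; rewrite coder_cons addrA.
Qed.

(** As in [coder_split], except that [h] acting in the left part also leaves [g] on every letter of
    the right part. *)
Lemma htpy_split (G : seq V -> seq V -> W) w :
  htpy (split_sum G) w =
  split_sum (fun u v => htpy (G^~ (map g v)) u + htpy (G (map K u)) v) w.
Proof.
elim: w G => // a w IHw G /=.
rewrite htpyD IHw addr0 split_sum_map !split_sumD -!addrA; congr (_ + _).
rewrite addrCA; congr (_ + _).
Qed.

End Target2.
End Operators.

Arguments eq_coder {k V K mu W P phi phi' w}.
Arguments eq_htpy {k V K h g W phi phi' w}.
Arguments eq_coder_pred {k V K mu W P} P' {phi w}.
Arguments raddf_coder {k V K mu W W' L}.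
Arguments raddf_htpy {k V K h g W W' L}.
Arguments coder0 {k V K mu W P phi w}.
Arguments htpy0 {k V K h g W phi w}.

(** * Square-zero coderivations and the tensor homotopy *)

Section Perturbation.
Variables (k : fieldType) (V : lmodType k).
Variables (K h g : {linear V -> V}) (mu : seq V -> V).
Hypothesis mu_mlin : mlin mu.
Local Notation coder := (coder K mu).
Local Notation htpy := (htpy K h g).

Section Operators.
Variable W : lmodType k.
Implicit Types (phi : seq V -> W) (P : pred nat).

Lemma coder_mlin P phi : mlin phi -> mlin (coder P phi).
Proof.
move=> phiL; apply: mlinP => l r c x y.
have split_mlin : forall psi : seq V -> W, mlin psi ->
    mlin (split_sum (fun u v => if P (size u) then psi (mu u :: v) else 0)).
  move=> psi psiL; apply: mlin_split_sum => [u _|v l' r' c' x' y'].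
    case: (P (size u)); first exact: mlin_cons.
    by apply: mlinP => *; rewrite scaler0 addr0.
  rewrite !size_cat /=; case: ifP => _; last by rewrite scaler0 addr0.
  by rewrite (mlinE mu_mlin) (mlinE psiL [::]).
elim: l phi phiL => [|b l IHl] phi phiL.
  rewrite !cat0s !coder_cons (mlinE (split_mlin _ phiL) [::]).
  rewrite [in RHS]scalerDr [RHS]addrACA.
  congr (_ + _); rewrite -coderZ -coderD.
  by apply: eq_coder => *; rewrite linearP (mlinE phiL [::]).
rewrite !cat_cons !coder_cons -!cat_cons (mlinE (split_mlin _ phiL)).
rewrite [in RHS]scalerDr [RHS]addrACA; congr (_ + _).
by apply: IHl; apply: mlin_cons.
Qed.

Lemma htpy_mlin phi : mlin phi -> mlin (htpy phi).
Proof.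
move=> phiL; apply: mlinP => l r c x y.
elim: l phi phiL => [|b l IHl] phi phiL /=.
  rewrite linearP (mlinE phiL [::]) [in RHS]scalerDr [RHS]addrACA.
  congr (_ + _).
  rewrite -htpyZ -htpyD.
  by apply: eq_htpy => *; rewrite linearP (mlinE phiL [::]).
rewrite !map_cat /= linearP -!cat_cons (mlinE phiL).
rewrite [in RHS]scalerDr [RHS]addrACA.
by congr (_ + _); apply: IHl; apply: mlin_cons.
Qed.

Hypothesis KK : involutive K.
Hypothesis mu_K : forall w, (0 < size w)%N -> mu (map K w) = - K (mu w).

(** Nested contractions vanish by the hypothesis on the corestriction. Contractions of two disjoint
    blocks occur in both orders and cancel, because [mu] anticommutes with [K]. *)
Lemma coder_coder P phi w : mlin phi ->
    (forall u, coder P (fun y => if P (size y) then mu y else 0) u = 0) ->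
  coder P (coder P phi) w = 0.
Proof.
move=> phiL D0; elim: w phi phiL => // a w IHw phi phiL.
pose G u v := if P (size u) then phi (mu u :: v) else 0.
pose xi y := if y is c :: y' then coder P (fun x => phi (K c :: x)) y' else 0.
rewrite (eq_coder (phi' := fun y => split_sum G y + xi y)); last first.
  by move=> j [|c y] // *; rewrite coder_cons.
rewrite coderD coder_split coder_cons.
have -> : coder P (fun y => xi (K a :: y)) w = 0.
  by rewrite /xi KK; apply: IHw; apply: mlin_cons.
rewrite addr0 -split_sumD; apply: split_sum0 => u v u0 _.
pose L c := phi (c :: v).
have -> : coder P (G^~ v) u =
    L (coder P (fun y => if P (size y) then mu y else 0) u).
  rewrite (raddf_coder (L := L)) /L; last first.
  - by move=> x y; rewrite (mlinD phiL [::]).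
  - by rewrite (mlin0 phiL [::]).
  apply: eq_coder => j y _ _ _ _ /=; rewrite /G; case: ifP => // _.
  by rewrite (mlin0 phiL [::]).
rewrite D0 /L (mlin0 phiL [::]) add0r /G size_map.
case: ifP => _; last by rewrite coder0 ?addr0.
rewrite /xi -coderD coder0 // => j y *.
by rewrite mu_K // (mlinN phiL [::]) addNr.
Qed.

Lemma coder1_cons phi a w :
  coder (pred1 1%N) phi (a :: w) =
  phi (mu [:: a] :: w) + coder (pred1 1%N) (fun y => phi (K a :: y)) w.
Proof.
rewrite coder_cons split_sum_cons split_sum0 ?addr0 // => u v u0 _.
by rewrite /= eqSS; case: u u0.
Qed.

Hypothesis homotopy : forall a, a - g a = mu [:: h a] + h (mu [:: a]).
Hypothesis mu1_g : forall a, mu [:: g a] = 0.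
Hypothesis g_mu1 : forall a, g (mu [:: a]) = 0.

Lemma coder1_map_g phi w : mlin phi -> coder (pred1 1%N) phi (map g w) = 0.
Proof.
elim: w phi => // a w IHw phi phiL.
rewrite map_cons coder1_cons mu1_g (mlin0 phiL [::]) add0r IHw //.
exact: mlin_cons.
Qed.

Lemma coder1_comp_map_g phi w : mlin phi ->
  coder (pred1 1%N) (fun y => phi (map g y)) w = 0.
Proof.
elim: w phi => // a w IHw phi phiL.
rewrite coder1_cons /= g_mu1 (mlin0 phiL [::]) add0r.
by rewrite (IHw (fun y => phi (g (K a) :: y))) //; apply: mlin_cons.
Qed.

(** The tensor trick. Terms where [h] and [mu] act on different letters cancel by [mu_K] or vanish
    because [mu] and [g] compose to zero on single letters. On equal letters [homotopy] replaces [a]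
    by [a - g a], and the sum telescopes along the word. *)
Lemma htpy_homotopy phi w : mlin phi ->
  htpy (coder (pred1 1%N) phi) w + coder (pred1 1%N) (htpy phi) w =
  phi w - phi (map g w).
Proof.
elim: w phi => [|a w IHw] phi phiL; first by rewrite addr0 subrr.
rewrite htpy_cons !coder1_cons htpy_cons.
have -> : htpy (fun y => coder (pred1 1%N) phi (K a :: y)) w =
    htpy (fun y => phi (mu [:: K a] :: y)) w +
    htpy (coder (pred1 1%N) (fun y => phi (a :: y))) w.
  by rewrite -htpyD; apply: eq_htpy => y _; rewrite coder1_cons KK.
have -> : coder (pred1 1%N) (fun y => htpy phi (K a :: y)) w =
    coder (pred1 1%N) (htpy (fun y => phi (a :: y))) w.
  rewrite (eq_coder (phi' := fun y => phi (h (K a) :: map g y) +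
               htpy (fun y => phi (a :: y)) y)); last first.
    by move=> j y *; rewrite /= KK.
  rewrite coderD (coder1_comp_map_g (phi := fun y => phi (h (K a) :: y))).
    by rewrite add0r.
  exact: mlin_cons.
rewrite (coder1_map_g (phi := fun y => phi (K (h a) :: y))); last first.
  exact: mlin_cons.
rewrite addr0 (mu_K (w := [:: a])) //.
rewrite (eq_htpy (phi := fun y => phi (- K (mu [:: a]) :: y))
                 (phi' := fun y => - phi (K (mu [:: a]) :: y))); last first.
  by move=> y _; rewrite (mlinN phiL [::]).
rewrite htpyN; set X := htpy (fun y => phi (K (mu _) :: y)) w.
have -> (x y z t : W) : x + (- X + y) + (z + X + t) = (x + z) + (y + t).
  rewrite [x + _]addrCA [z + X]addrC -[X + z + t]addrA addrACA addNr add0r.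
  exact: addrACA.
rewrite IHw; last exact: mlin_cons.
rewrite -(mlinD phiL [::]) -homotopy (mlinD phiL [::]) (mlinN phiL [::]) /=.
by rewrite addrC addrA addrNK.
Qed.

Hypothesis hh : forall a, h (h a) = 0.
Hypothesis hg : forall a, h (g a) = 0.
Hypothesis gh : forall a, g (h a) = 0.

Lemma htpy_map_g phi w : mlin phi -> htpy phi (map g w) = 0.
Proof.
elim: w phi => //= a w IHw phi phiL.
by rewrite hg (mlin0 phiL [::]) add0r IHw //; apply: mlin_cons.
Qed.

Lemma htpy_comp_map_g phi w : mlin phi -> htpy (fun y => phi (map g y)) w = 0.
Proof.
elim: w phi => //= a w IHw phi phiL.
rewrite gh (mlin0 phiL [::]) add0r (IHw (fun y => phi (g (K a) :: y))) //.
exact: mlin_cons.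
Qed.

(** Two homotopies on the same letter die by [hh]; on different letters one of them meets a [g], and
    [hg] or [gh] applies. *)
Lemma htpy_htpy phi w : mlin phi -> htpy (htpy phi) w = 0.
Proof.
elim: w phi => //= a w IHw phi phiL.
rewrite hh (mlin0 phiL [::]) add0r htpy_map_g; last exact: mlin_cons.
rewrite add0r htpyD (htpy_comp_map_g (phi := fun y => phi (h (K a) :: y))).
  by rewrite KK IHw ?addr0 //; apply: mlin_cons.
exact: mlin_cons.
Qed.

End Operators.
End Perturbation.

(** * Coalgebra maps given by their corestriction *)

(* [psi] composed with the part with values in [H^{(x)r}] of the coalgebra map
   with corestriction [q]. *)
Fixpoint blockmap (k : fieldType) (V H W : lmodType k) (q : seq V -> H)
    (r : nat) (psi : seq H -> W) (w : seq V) : W :=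
  if r is r'.+1 then
    split_sum (fun u v => blockmap q r' (fun y => psi (q u :: y)) v) w
  else if w is [::] then psi [::] else 0.

Section Blockmap.
Variables (k : fieldType) (V H W : lmodType k) (q : seq V -> H).
Implicit Types psi : seq H -> W.

Lemma blockmapS r psi w :
  blockmap q r.+1 psi w =
  split_sum (fun u v => blockmap q r (fun y => psi (q u :: y)) v) w.
Proof. by []. Qed.

Lemma blockmapD r psi psi' w :
  blockmap q r (fun y => psi y + psi' y) w =
  blockmap q r psi w + blockmap q r psi' w.
Proof.
elim: r psi psi' w => [|r IHr] psi psi' w /=.
  by case: w => [|a w]; rewrite ?addr0.
by rewrite -split_sumD; apply: eq_split_sum => *; rewrite IHr.
Qed.

Lemma eq_blockmap r psi psi' w :
  psi =1 psi' -> blockmap q r psi w = blockmap q r psi' w.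
Proof.
elim: r psi psi' w => [|r IHr] psi psi' w E /=.
  by case: w => [|a w]; rewrite ?E.
by apply: eq_split_sum => *; apply: IHr => y; apply: E.
Qed.

Lemma blockmap_head0 r psi w : mlin psi ->
  blockmap q r (fun y => psi (0 :: y)) w = 0.
Proof.
move=> psiL; rewrite (@eq_blockmap _ _ (fun y => 0)); last first.
  by move=> y; rewrite (mlin0 psiL [::]).
elim: r w => [|r IHr] [|a w] //=.
by rewrite IHr add0r split_sum0.
Qed.

Lemma blockmap_headD r psi w x y : mlin psi ->
  blockmap q r (fun z => psi (x + y :: z)) w =
  blockmap q r (fun z => psi (x :: z)) w +
  blockmap q r (fun z => psi (y :: z)) w.
Proof.
move=> psiL; rewrite -blockmapD; apply: eq_blockmap => z.
by rewrite (mlinD psiL [::]).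
Qed.

End Blockmap.

(** * The perturbation argument, free of signs *)

Section Transfer.
Variables (k : fieldType) (V H : lmodType k).
Variables (K h g : {linear V -> V}) (mu : seq V -> V).
Variables (KH : {linear H -> H}) (p : {linear V -> H}) (q : seq V -> H).
Local Notation coder := (coder K mu).
Local Notation htpy := (htpy K h g).
Local Notation many := (fun j => 1 < j)%N.

(** The corestriction of the coalgebra map P induced by [p]. *)
Definition first1 (w : seq V) : H := if w is [:: a] then p a else 0.

Hypothesis mu_mlin : mlin mu.
Hypothesis KK : involutive K.
Hypothesis hh : forall a, h (h a) = 0.
Hypothesis hg : forall a, h (g a) = 0.
Hypothesis gh : forall a, g (h a) = 0.
Hypothesis ph : forall a, p (h a) = 0.
Hypothesis pg : forall a, p (g a) = p a.
Hypothesis q_mlin : mlin q.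
Hypothesis q_K : forall w, q (map K w) = KH (q w).
Hypothesis q_rec : forall w, q w = first1 w - htpy (coder many q) w.

(** Unfolding the recursion for [q] once leaves p H, zero by [ph], and a term ending in H H, zero by
    [htpy_htpy]. *)
Lemma htpy_q w : htpy q w = 0.
Proof.
rewrite (eq_htpy (phi' := fun y => first1 y + - htpy (coder many q) y)) //.
rewrite htpyD htpyN htpy_htpy //; last exact: coder_mlin.
rewrite subr0; case: w => [|a [|b w]] //=; first by rewrite ph addr0.
by rewrite htpy0 ?addr0 // => -[|c [|]].
Qed.

Lemma q_map_g w : q (map g w) = first1 w.
Proof.
rewrite q_rec htpy_map_g ?subr0 //; last exact: coder_mlin.
by case: w => [|a []] //=; rewrite pg.
Qed.

(** F H = 0: by [htpy_split] the [h] lands in a single block, where [htpy_q] kills it. *)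
Lemma htpy_blockmap (W : lmodType k) r (psi : seq H -> W) w :
  mlin psi -> htpy (blockmap q r psi) w = 0.
Proof.
elim: r psi w => [|r IHr] psi w psiL.
  by case: w => // a w; apply: htpy0 => -[].
rewrite [blockmap _ _ _]/= htpy_split; apply: split_sum0 => u v _ _.
rewrite IHr ?addr0; last exact: mlin_cons.
pose L c := blockmap q r (fun y => psi (c :: y)) (map g v).
have L0 : L 0 = 0 by apply: blockmap_head0.
have LD : {morph L : x y / x + y} by move=> x y; apply: blockmap_headD.
by rewrite -[LHS](raddf_htpy (L := L)) // htpy_q.
Qed.

(** F I P = P: on letters of the form [g a] the corestriction [q] reduces to [first1], so only the
    cut into single letters survives. *)
Lemma blockmap_map_g (W : lmodType k) r (psi : seq H -> W) w : mlin psi ->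
  blockmap q r psi (map g w) = if size w == r then psi (map p w) else 0.
Proof.
elim: r psi w => [|r IHr] psi w psiL; first by case: w.
case: w => [|a w] //; rewrite blockmapS.
rewrite split_sum_map split_sum_cons (q_map_g [:: a]) IHr; last first.
  exact: mlin_cons.
rewrite split_sum0 ?addr0 // => -[//|b u] v _ _.
rewrite (q_map_g [:: a, b & u]) blockmap_head0 //.
Qed.

(* In the composite [F delta H] of the coalgebra map [F], the coderivation
   [delta] and the homotopy [H], only the summand in which [delta] and [H] hit
   the same block survives; the recursion for [q] makes the resulting sum over
   blocks telescope. *)
Lemma blockmap_rec (W : lmodType k) r (psi : seq H -> W) w : mlin psi ->
  blockmap q r psi w =
  (if size w == r then psi (map p w) else 0) -
  htpy (coder many (blockmap q r psi)) w.
Proof.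
elim: r psi w => [|r IHr] psi w psiL.
  case: w => [|a w]; first by rewrite /= subr0.
  by rewrite htpy0 ?subr0 // => y _; rewrite coder0 // => j [].
set G := fun u => blockmap q r (fun y => psi (q u :: y)).
have GL u : mlin (fun y => psi (q u :: y)) by apply: mlin_cons.
have G_add y : {morph (fun c => blockmap q r (fun z => psi (c :: z)) y) :
    x x' / x + x'} by move=> x x'; apply: blockmap_headD.
have G0 y : blockmap q r (fun z => psi (0 :: z)) y = 0.
  exact: blockmap_head0.
have coder_G x y : coder many (G^~ y) x =
    blockmap q r (fun z => psi (coder many q x :: z)) y.
  by rewrite [RHS](raddf_coder many q x (G0 y) (G_add y)).
rewrite [blockmap _ _ _]/= -/G.
rewrite (eq_htpy (phi' := split_sum (fun u v =>
    coder many (G^~ v) u + coder many (G (map K u)) v))); last first.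
  by move=> y _; rewrite coder_split.
rewrite htpy_split.
rewrite [X in _ = _ - X](eq_split_sum (G' := fun u v =>
    (if size v == r then psi (first1 u :: map p v) else 0) - G u v)).
  rewrite split_sumD split_sumN opprD opprK addrA.
  suff -> : split_sum (fun u v =>
      if size v == r then psi (first1 u :: map p v) else 0) w =
      if size w == r.+1 then psi (map p w) else 0 by rewrite subrr add0r.
  case: w => [|a w] //; rewrite split_sum_cons split_sum0 ?addr0 //.
  case=> [//|b u] v _ _; case: ifP => // _.
  by rewrite (mlin0 psiL [::]).
move=> u v _ _.
rewrite htpyD (eq_htpy (phi' := fun x =>
  blockmap q r (fun z => psi (coder many q x :: z)) (map g v))) //.
rewrite -[X in X + _ + _](raddf_htpy (coder many q) u (G0 _) (G_add _)).
have -> : htpy (coder many q) u = first1 u - q u.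
  by rewrite [X in _ - X]q_rec opprB addrC subrK.
rewrite blockmap_map_g; last exact: mlin_cons.
(* Here [h] acts in [u] and the contraction in [v]. Moving [K] through [q] by [q_K] turns this into
   an additive function of [htpy q u], which is zero. *)
have -> : htpy (fun x => coder many (G (map K x)) (map g v)) u = 0.
  pose L c := coder many (blockmap q r (fun z => psi (KH c :: z))) (map g v).
  have L0 : L 0 = 0 by apply: coder0 => *; rewrite raddf0.
  have LD : {morph L : x y / x + y}.
    move=> x y; rewrite /L -coderD; apply: eq_coder => *.
    by rewrite raddfD G_add.
  rewrite (eq_htpy (phi' := L \o q)); first by rewrite -raddf_htpy // htpy_q.
  by move=> y _; rewrite /= /L /G q_K.
rewrite addr0 htpyD.
rewrite (eq_htpy (phi' := blockmap q r
  (fun z => psi (coder many q (map K u) :: z)))); last first.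
  by move=> *; apply: coder_G.
rewrite htpy_blockmap ?add0r; last exact: mlin_cons.
rewrite -map_comp (eq_map (g := id)) ?map_id //.
have -> : htpy (coder many (G u)) v =
    (if size v == r then psi (q u :: map p v) else 0) - G u v.
  by rewrite [X in _ - X]IHr // opprB addrC subrK.
(* The telescoping: the [q u] parts of the two surviving terms cancel and leave [first1 u]. *)
rewrite addrA; congr (_ - _); case: ifP => _; last exact: addr0.
by rewrite -(mlinD psiL [::]) subrK.
Qed.

Hypothesis mu_K : forall w, (0 < size w)%N -> mu (map K w) = - K (mu w).
Hypothesis homotopy : forall a, a - g a = mu [:: h a] + h (mu [:: a]).
Hypothesis mu1_g : forall a, mu [:: g a] = 0.
Hypothesis p_mu1 : forall a, p (mu [:: a]) = 0.
Hypothesis g_mu1 : forall a, g (mu [:: a]) = 0.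
Hypothesis ainf : forall w, coder predT mu w = 0.

Variable mH : seq H -> H.
Hypothesis mH_mlin : mlin mH.
Hypothesis mH_p : forall w, mH (map p w) = coder many q (map g w).

Lemma coder_predT (W : lmodType k) (phi : seq V -> W) w :
  coder predT phi w = coder (pred1 1%N) phi w + coder many phi w.
Proof. by apply: coder_pred2 => -[|[]]. Qed.

Lemma coder_first1 P w :
  coder P first1 w = if (0 < size w)%N && P (size w) then p (mu w) else 0.
Proof.
case: w => // a w; rewrite coder_cons coder0 ?addr0; last by move=> j [].
rewrite split_sum_full // => u [//|b v] *; by case: ifP.
Qed.

(** From b b = 0 and d d = 0 follows q b delta = - q delta d, so the claim is q b = m' P + q delta d
    H. It results from inserting id = d H + H d + I P after q delta: the term q delta H d cancels q
    d, because q = p - q delta H and p d = 0. *)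
Lemma coder_q_rec w :
  coder predT q w = mH (map p w) - htpy (coder many (coder predT q)) w.
Proof.
set dq := coder many q; have dqL : mlin dq by apply: coder_mlin.
have ddq y : coder many (coder predT q) y = - coder (pred1 1%N) dq y.
  apply/eqP; rewrite -addr_eq0 addrC.
  have := coder_coder KK mu_K (P := predT) y q_mlin ainf.
  (* d d = 0 needs checking on single letters only: on a longer word, contracting one letter leaves
     a word still too long for its corestriction to be nonzero. *)
  have d1d1 : coder (pred1 1%N) (coder (pred1 1%N) q) y = 0.
    apply: coder_coder => // u; have m1m1 x : mu [:: mu [:: x]] = 0.
      by have := ainf [:: x]; rewrite /= !addr0.
    case: u => [|a [|b u]] //; first by rewrite /= !addr0 m1m1.
    rewrite coder0 // => j y' j0 /eqP -> _ ->.
    by [].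
  rewrite coder_predT.
  rewrite (eq_coder (P := pred1 1%N)
     (phi' := fun x => coder (pred1 1%N) q x + dq x)).
    by rewrite coderD d1d1 add0r => /eqP.
  by move=> *; rewrite coder_predT.
rewrite (eq_htpy (phi' := fun y => - coder (pred1 1%N) dq y)) //.
rewrite htpyN opprK mH_p -/dq.
have E : dq w = htpy (coder (pred1 1%N) dq) w +
    coder (pred1 1%N) (htpy dq) w + dq (map g w).
  by rewrite htpy_homotopy // subrK.
rewrite coder_predT -/dq E.
have d1q : coder (pred1 1%N) q w = - coder (pred1 1%N) (htpy dq) w.
  rewrite -coderN -[RHS]add0r.
  have {1}<- : coder (pred1 1%N) first1 w = 0.
    rewrite coder_first1; case: ifP => // /andP[_ /eqP].
    by case: w {E} => [|a []] //; rewrite p_mu1.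
  by rewrite -coderD; apply: eq_coder => *; apply: q_rec.
by rewrite d1q -addrA addrCA addKr addrC.
Qed.

(** By [blockmap_rec] the right side obeys the recursion of [coder_q_rec]: among the terms in
    [size w == r] just the one with [r] the length of [w] remains, so [n] must be at least that
    length. Two solutions of this recursion agree by induction on the length. *)
Theorem transfer_morphism n w : (0 < size w <= n)%N ->
  coder predT q w = \sum_(1 <= r < n.+1) blockmap q r mH w.
Proof.
have mH0 : mH [::] = 0 by have := mH_p [::].
set R := fun w => \sum_(1 <= r < n.+1) blockmap q r mH w.
have RE v : (0 < size v <= n)%N ->
    R v = mH (map p v) - htpy (coder many R) v.
  move=> v_n; rewrite /R.
  under eq_bigr do rewrite blockmap_rec //.
  rewrite big_split /= sumrN; congr (_ - _).
    rewrite -big_mkcond; under eq_bigl do rewrite eq_sym.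
    by rewrite big_nat1_eq ltnS v_n.
  rewrite -htpy_sum; apply: eq_htpy => y _; by rewrite -coder_sum.
move: {2}(size w) (leqnn (size w)) => s; elim: s w => [|s IHs] w ws w_n.
  by move: w_n; rewrite lt0n; case/andP => /negP[]; rewrite -leqn0.
rewrite coder_q_rec -/(R w) RE //; congr (_ - _).
(* H preserves length and contracting [j > 1] letters lowers it, which puts [z] in reach of the
   induction hypothesis. *)
apply: eq_htpy => y yw; apply: eq_coder => j z j0 j1 jy zy.
apply: IHs; rewrite zy; lia.
Qed.

End Transfer.

(** * Koszul sign operators *)

Section Koszul.
Variables (k : fieldType) (V : graded k).
Implicit Types (u v w : V) (d e : int).

Lemma homog0 d : homog d (0 : V).
Proof. by rewrite /homog raddf0. Qed.

Lemma homogD d u v : homog d u -> homog d v -> homog d (u + v).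
Proof. by rewrite /homog raddfD /= => -> ->. Qed.

Lemma homogN d v : homog d v -> homog d (- v).
Proof. by rewrite /homog raddfN /= => ->. Qed.

Lemma homogZ d a v : homog d v -> homog d (a *: v).
Proof. by rewrite /homog linearZ /= => ->. Qed.

Lemma homog_ind (P : V -> Prop) :
    P 0 -> (forall u v, P u -> P v -> P (u + v)) ->
    (forall d v, homog d v -> P v) ->
  forall v, P v.
Proof.
move=> P0 PD Ph v; have [s _ ->] := gproj_sum v.
elim: s => [|d s IHs]; first by rewrite big_nil.
rewrite big_cons; apply: PD => //; apply: (Ph d).
by rewrite /homog gprojK eqxx.
Qed.

Lemma gproj_sum_sub (s s' : seq int) v :
    uniq s -> uniq s' -> {subset s <= s'} -> v = \sum_(d <- s) gproj d v ->
  v = \sum_(d <- s') gproj d v.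
Proof.
move=> us us' ss' vE.
rewrite (bigID (mem s)) /= [X in _ + X]big1 ?addr0; last first.
  by move=> d /(gproj_notin vE).
rewrite -big_filter [LHS]vE; apply: perm_big; apply: uniq_perm => //.
  exact: filter_uniq.
by move=> d; rewrite mem_filter /=; case: (boolP (d \in s)) => // /ss' ->.
Qed.

Lemma koszul_linear d : linear (@koszul k V d).
Proof.
move=> a u v; have [su us uE] := gproj_sum u; have [sv vs vE] := gproj_sum v.
(* A common finite support, so that the sums computing [koszul] on both vectors have the same index
   set. *)
set s := undup (su ++ sv); have s_uniq : uniq s by apply: undup_uniq.
have {us}uE : u = \sum_(d <- s) gproj d u.
  by apply: gproj_sum_sub uE => // x xs; rewrite mem_undup mem_cat xs.
have {vs}vE : v = \sum_(d <- s) gproj d v.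
  by apply: gproj_sum_sub vE => // x xs; rewrite mem_undup mem_cat xs orbT.
rewrite (koszulE d s_uniq uE) (koszulE d s_uniq vE).
rewrite (koszulE (s := s)) //; last first.
  rewrite {1}uE {1}vE scaler_sumr -big_split /=.
  by apply: eq_bigr => e _; rewrite linearP.
rewrite scaler_sumr -big_split /=; apply: eq_bigr => e _.
by rewrite linearP scalerDr !scalerA mulrC.
Qed.

HB.instance Definition _ d :=
  GRing.isLinear.Build k V V *:%R (@koszul k V d) (koszul_linear d).

(* The sign operator [v |-> (-1)^(|v|+1) v] of the suspension of [V]. *)
Definition kt (v : V) : V := - koszul 1 v.

Lemma kt_linear : linear kt.
Proof. by move=> a u v; rewrite /kt linearP opprD scalerN. Qed.

HB.instance Definition _ := GRing.isLinear.Build k V V *:%R kt kt_linear.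

Lemma koszul1 v : koszul 1 v = - kt v.
Proof. by rewrite opprK. Qed.

Lemma kt_homog e v : homog e v -> kt v = (-1) ^+ `|e|.+1 *: v.
Proof.
by move=> ve; rewrite /kt (koszul_homog _ ve) mul1r exprS mulN1r scaleNr.
Qed.

Lemma homog_kt e v : homog e v -> homog e (kt v).
Proof. by move=> ve; rewrite (kt_homog ve); apply: homogZ. Qed.

Lemma ktK : involutive kt.
Proof.
apply: homog_ind => [|u v uE vE|e v ve]; first by rewrite !raddf0.
  by rewrite !raddfD /= uE vE.
rewrite (kt_homog ve) linearZ /= (kt_homog ve) scalerA -expr2.
by rewrite sqrr_sign scale1r.
Qed.

Lemma iter_kt n v : iter n kt v = if odd n then kt v else v.
Proof. by elim: n => //= n ->; case: (odd n); rewrite ?ktK. Qed.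

Lemma homog_iter_kt n e v : homog e v -> homog e (iter n kt v).
Proof. by rewrite iter_kt; case: odd => //; apply: homog_kt. Qed.

Lemma iter_ktP n a u v :
  iter n kt (a *: u + v) = a *: iter n kt u + iter n kt v.
Proof. by rewrite !iter_kt; case: odd => //; rewrite linearP. Qed.

Lemma iter_ktZ n a v : iter n kt (a *: v) = a *: iter n kt v.
Proof. by rewrite !iter_kt; case: odd => //; rewrite linearZ. Qed.

Lemma iter_ktD m n v : iter m kt (iter n kt v) = iter (m + n) kt v.
Proof. by rewrite iterD. Qed.

Lemma iter_ktK n v : iter n kt (iter n kt v) = v.
Proof. by rewrite !iter_kt; case: odd; rewrite ?ktK. Qed.

(** Trades the Koszul operators of all degrees for scalars and powers of the one involution [kt]. *)
Lemma koszul_kt d v : koszul d v = (-1) ^+ `|d| *: iter `|d| kt v.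
Proof.
elim/homog_ind: v => [|u v uE vE|e v ve].
- by rewrite raddf0 iter_kt raddf0 if_same scaler0.
- by rewrite raddfD /= uE vE -scalerDr -[u in RHS]scale1r iter_ktP scale1r.
rewrite (koszul_homog _ ve) iter_kt -signr_odd abszM oddM.
rewrite -[in RHS]signr_odd; case: (odd `|d|); last by rewrite !scale1r.
by rewrite (kt_homog ve) scalerA exprS expr1 !mulN1r opprK signr_odd.
Qed.

End Koszul.

Lemma signzD (R : pzRingType) (d e : int) :
  (-1) ^+ `|(d + e)%R| = (-1) ^+ `|d| * (-1) ^+ `|e| :> R.
Proof.
rewrite -exprD -signr_odd -[RHS]signr_odd; congr (_ ^+ _).
congr nat_of_bool; lia.
Qed.

Lemma signz_nat (R : pzRingType) (n c : nat) :
  (-1) ^+ `|(n%:Z - c%:Z)%R| = (-1) ^+ (n + c) :> R.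
Proof. by rewrite signzD abszN exprD. Qed.

Lemma koszul_nat (k : fieldType) (V : graded k) (n c : nat) (v : V) :
  koszul (n%:Z - c%:Z) v = (-1) ^+ (n + c) *: iter (n + c) (@kt k V) v.
Proof.
rewrite koszul_kt signz_nat !iter_kt; congr (_ *: _).
by have -> : odd `|(n%:Z - c%:Z)%R| = odd (n + c) by lia.
Qed.

(** * Homogeneous words and the degree of multilinear maps *)

(** A recursive form of the condition in [has_degree], suited to induction along the word. *)
Fixpoint homs (k : fieldType) (V : graded k) (e : seq int) (w : seq V) : Prop :=
  match e, w with
  | [::], [::] => True
  | x :: e', a :: w' => homog x a /\ homs e' w'
  | _, _ => False
  end.

Section Homs.
Variables (k : fieldType) (V W : graded k).

Lemma homsP (e : seq int) (w : seq V) : homs e w <->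
  size e = size w /\
  (forall j, (j < size w)%N -> homog (nth 0 e j) (nth 0 w j)).
Proof.
elim: e w => [|x e IHe] [|a w] //=; try by split=> // -[].
split=> [[xa /IHe[-> ew]]|[[ew] E]]; first by split=> // -[|j] //; apply: ew.
split; first exact: (E 0%N).
by apply/IHe; split=> // j jw; apply: (E j.+1).
Qed.

Lemma homs_size (e : seq int) (w : seq V) : homs e w -> size e = size w.
Proof. by case/homsP. Qed.

Lemma homs_rcons (e : seq int) (w : seq V) x a :
  homs e w -> homog x a -> homs (rcons e x) (rcons w a).
Proof.
elim: e w => [|y e IHe] [|b w] //= [yb ew] xa.
by split=> //; apply: IHe.
Qed.

Lemma has_degreeP n d (f : seq V -> W) : has_degree n d f <->
  (forall e w, size w = n -> homs e w -> homog (\sum_(x <- e) x + d) (f w)).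
Proof.
split=> [fd e w wn /homsP[ew E]|fd w e wn en E].
  by apply: fd => //; rewrite ?ew ?wn // => j jn; apply: E; rewrite wn.
by apply: fd => //; apply/homsP; rewrite wn.
Qed.

(** On homogeneous letters of total degree [e] the inputs contribute the exponent [e + n], the
    output [e + d + 1]; the two differ by [n + d + 1] modulo 2. *)
Lemma graded_map_kt n d (f : seq V -> W) w : graded_map n d f -> size w = n ->
  f (map (@kt k V) w) = (-1) ^+ (n + `|d|).+1 *: kt (f w).
Proof.
move=> [fL /has_degreeP fd] wn.
(* Letters are made homogeneous one at a time: [l] is the prefix already treated, and the scalar
   holds the signs of its twists. *)
suff E (r l : seq V) (e : seq int) : homs e l -> (size l + size r)%N = n ->
    f (l ++ map (@kt k V) r) =
    (-1) ^+ (`|(\sum_(x <- e) x)%R| + size l + (n + `|d|).+1) *: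
      kt (f (l ++ r)).
  by have := E w [::] [::] I wn; rewrite big_nil.
elim: r l e => [|a r IHr] l e le lrn.
  have {}lrn : size l = n by rewrite -lrn addn0.
  rewrite cats0 (kt_homog (fd _ _ lrn le)) scalerA -[LHS]scale1r.
  congr (_ *: _).
  rewrite [in RHS]exprS signzD lrn !exprD exprS exprD.
  set x := _ ^+ `|_|; set y := _ ^+ n; set z := _ ^+ `|_|.
  have [xx yy zz] : [/\ x * x = 1, y * y = 1 & z * z = 1].
    by split; rewrite -expr2 sqrr_sign.
  by transitivity ((x * x) * (y * y) * (z * z));
    [rewrite xx yy zz !mulr1 | ring].
have szE b : (size (rcons l b) + size r)%N = n by rewrite size_rcons addSnnS.
have lrE : (size l + size r).+1 = n by rewrite -lrn addnS.
have lrE' : (size l + size (map (@kt k V) r)).+1 = n by rewrite size_map.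
have f0 r' : (size l + size r').+1 = n -> f (l ++ 0 :: r') = 0.
  move=> E; apply: (addIr (f (l ++ 0 :: r'))).
  by rewrite add0r -{1}[f _]scale1r -fL // scale1r addr0.
elim/homog_ind: a {lrn} => [|u v uE vE|x a xa].
- by rewrite /= raddf0 !f0 // raddf0 scaler0.
- rewrite /= raddfD /= -[kt u]scale1r fL //.
  rewrite -[u in RHS]scale1r fL // linearP scalerDr !scale1r.
  by rewrite /= in uE vE *; rewrite scale1r uE vE.
rewrite /= (kt_homog xa) -[X in X :: _]addr0 fL // f0 // addr0.
rewrite -!cat_rcons (IHr _ (rcons e x)) //; last exact: homs_rcons.
rewrite scalerA; congr (_ *: _).
have -> : \sum_(y <- rcons e x) y = \sum_(y <- e) y + x :> int.
  by rewrite -cats1 big_cat big_seq1.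
rewrite !exprD signzD size_rcons !exprS !exprD; set y := _ ^+ `|x|.
have yy : y * y = 1 by rewrite -expr2 sqrr_sign.
set A := _ ^+ `|\sum_(z <- e) z|; set B := _ ^+ size l.
set C := _ ^+ n; set D := _ ^+ `|d|.
have -> : A * B * (-1 * (C * D)) = (y * y) * (A * B * (-1 * (C * D))).
  by rewrite yy mul1r.
by ring.
Qed.

End Homs.

(** * Suspension of words and of families of maps *)

Section Suspension.
Variables (k : fieldType) (V : graded k).
Implicit Types w : seq V.

(* On [s^{(x)n}] the Koszul rule puts the sign of the i-th letter to the power
   [n - i]; with [kt] in place of the plain sign operator all remaining signs
   of the A-infinity relations disappear. *)
Fixpoint susp w : seq V :=
  if w is a :: w' then iter (size w') (@kt k V) a :: susp w' else [::].

Lemma size_susp w : size (susp w) = size w.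
Proof. by elim: w => //= a w ->. Qed.

Lemma susp_cat u w :
  susp (u ++ w) = map (iter (size w) (@kt k V)) (susp u) ++ susp w.
Proof.
elim: u => //= a u ->; congr (_ :: _).
by rewrite iter_ktD size_cat addnC.
Qed.

Lemma suspK : involutive susp.
Proof. by elim=> //= a w ->; rewrite size_susp iter_ktK. Qed.

Lemma homs_susp e w : homs e w -> homs e (susp w).
Proof.
elim: e w => [|x e IHe] [|a w] //= [xa /IHe]; split=> //.
exact: homog_iter_kt.
Qed.

(** Gathers a family of maps, one for each arity, into a single functional on the tensor coalgebra
    of the suspension. *)
Definition suspended (W : Type) (f : nat -> seq V -> W) w :=
  f (size w) (susp w).

Lemma suspended_mlin (W : lmodType k) (f : nat -> seq V -> W) :
  (forall n, (0 < n)%N -> multilinear n (f n)) -> mlin (suspended f).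
Proof.
move=> fL; apply: mlinP => l r a u v.
rewrite /suspended !susp_cat !size_cat !addnS /= iter_ktP.
by rewrite fL // size_map !size_susp.
Qed.

End Suspension.

Lemma susp_map (k : fieldType) (V W : graded k) (f : V -> W) (w : seq V) :
  (forall a, f (kt a) = kt (f a)) -> susp (map f w) = map f (susp w).
Proof.
move=> fk; elim: w => //= a w ->; congr (_ :: _).
by rewrite size_map !iter_kt; case: odd.
Qed.

(** * Tensor products of maps evaluated on words *)

Section Tensor.
Variables (k : fieldType) (V : graded k).
Implicit Types w : seq V.

Lemma size_tensor (W : Type) (fs : seq (factor V W)) w :
  size (tensor fs w) = size fs.
Proof. by elim: fs w => //= f fs IHfs w; rewrite IHfs. Qed.

Lemma sum_dg_unary0 (W : lmodType k) n (f : V -> W) :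
  \sum_(g <- nseq n (unary 0 f)) dg g = 0.
Proof. by rewrite big_nseq iter_addr addr0 mul0rn. Qed.

Lemma tensor_unary0 (W : lmodType k) (f : V -> W) w :
  tensor (nseq (size w) (unary 0 f)) w = map f w.
Proof.
elim: w => //= a w IHw; rewrite drop0 IHw; congr (_ :: _).
by rewrite sum_dg_unary0 koszul0.
Qed.

Lemma tensor_fid (F : factor V V) (gs : seq (factor V V)) u w :
  tensor (nseq (size u) fid ++ F :: gs) (u ++ w) =
  map (koszul (dg F + \sum_(f <- gs) dg f)) u ++ tensor (F :: gs) w.
Proof.
elim: u => [//|a u IHu]; rewrite [size _]/= -[nseq _ _]/(fid :: nseq _ fid).
rewrite !cat_cons -IHu /= drop0; congr (koszul _ a :: _).
by rewrite big_cat big_cons /= sum_dg_unary0 add0r.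
Qed.

(** Only [F] may have nonzero degree, so only the letters to its left acquire a Koszul sign. The map
    [f] will be the identity for [m_j^n] and [ip] for [h_n]. *)
Lemma tensor_block (F : factor V V) (f : V -> V) u b v : ar F = size b ->
  tensor (nseq (size u) fid ++ F :: nseq (size v) (unary 0 f)) (u ++ b ++ v) =
  map (koszul (dg F)) u ++ fn F b :: map f v.
Proof.
move=> Fb; rewrite tensor_fid sum_dg_unary0 addr0 /= sum_dg_unary0 Fb.
rewrite take_size_cat // drop_size_cat // tensor_unary0.
by rewrite (eq_map (@koszul0 k V)) map_id.
Qed.

End Tensor.

Section ExplicitSums.
Variables (k : fieldType) (V W : lmodType k) (K h g : V -> V).
Variable mu : seq V -> V.
Implicit Types (phi : seq V -> W) (w : seq V).

Lemma coder_pred1_sum j phi w : (0 < j <= size w)%N ->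
  coder K mu (pred1 j) phi w =
  \sum_(0 <= r < (size w - j).+1)
    phi (map K (take r w) ++ mu (take j (drop r w)) :: drop (r + j) w).
Proof.
case/andP=> j0; elim: w phi => [|a w IHw] phi jw.
  by move: j0; rewrite ltnNge jw.
rewrite coder_cons split_sum_nat.
have -> : \sum_(1 <= i < (size (a :: w)).+1)
    (if pred1 j (size (take i (a :: w)))
     then phi (mu (take i (a :: w)) :: drop i (a :: w)) else 0) =
    phi (mu (take j (a :: w)) :: drop j (a :: w)).
  pose F i := phi (mu (take i (a :: w)) :: drop i (a :: w)).
  transitivity (\sum_(1 <= i < (size (a :: w)).+1 | i == j) F i).
    rewrite [RHS]big_mkcond; apply: eq_big_nat => i /andP[_ iw].
    by rewrite size_takel.
  by rewrite big_nat1_eq ltnS j0 jw.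
rewrite big_nat_recl // take0 drop0 add0n; congr (_ + _).
move: jw; rewrite leq_eqVlt => /predU1P[jw|jw].
  rewrite jw subnn big_geq // coder0 // => i y i0 /eqP -> /=.
  by rewrite ltnn.
by rewrite IHw // /= subSn.
Qed.

Lemma htpy_nat phi w :
  htpy K h g phi w =
  \sum_(0 <= r < size w)
    phi (map K (take r w) ++ h (nth 0 w r) :: map g (drop r.+1 w)).
Proof.
elim: w phi => [|a w IHw] phi; first by rewrite big_geq.
by rewrite htpy_cons big_nat_recl //= drop0 IHw.
Qed.

Lemma sum_coder_pred1 (s : seq nat) phi w : uniq s ->
  \sum_(j <- s) coder K mu (pred1 j) phi w =
  coder K mu (fun j => j \in s) phi w.
Proof.
elim: s => [|j s IHs] /=.
  rewrite big_nil; elim: w phi => // a w IHw phi _.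
  by rewrite coder_cons -IHw // addr0 split_sum0.
case/andP=> js us; rewrite big_cons IHs //.
symmetry; apply: coder_pred2 => i.
  by rewrite /= inE; case: eqVneq => // ->; rewrite (negbTE js).
by apply/negP => /= /andP[/eqP -> ]; rewrite (negbTE js).
Qed.

End ExplicitSums.

(** * The signs of [m_j^n] and [h_n] under suspension *)

Section Translation.
Variables (k : fieldType) (V : graded k) (W : lmodType k).
Variables (m : nat -> seq V -> V) (phi : seq V -> W).
Hypothesis m_graded : forall n, (0 < n)%N -> graded_map n (n%:Z - 2) (m n).
Hypothesis phi_mlin : mlin phi.
Implicit Types w : seq V.
Local Notation kt := (@kt k V).

Lemma eq_comp_m j n (psi psi' : seq V -> W) w :
    (forall y, size y = (n - j).+1 -> psi y = psi' y) ->
  comp_m m j n psi w = comp_m m j n psi' w.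
Proof.
move=> E; rewrite /comp_m; apply: eq_big_nat => r /andP[_ rn].
rewrite E // size_tensor size_cat /= !size_nseq; lia.
Qed.

(** After suspension every [m n] is odd: the exponent [n + (n - 2) + 1] is. *)
Lemma m_kt n w : (0 < n)%N -> size w = n -> m n (map kt w) = - kt (m n w).
Proof.
move=> n0 wn; rewrite (graded_map_kt (m_graded n0) wn).
rewrite -scaleN1r exprS exprD (signz_nat _ n 2) -exprD addnA addnn.
by rewrite -signr_odd oddD odd_double mulr1.
Qed.

Lemma m_iter_kt n t w : (0 < n)%N -> size w = n ->
  m n (map (iter t kt) w) = (-1) ^+ t *: iter t kt (m n w).
Proof.
move=> n0 wn; elim: t => [|t IHt] /=; first by rewrite map_id scale1r.
rewrite map_comp m_kt ?size_map // IHt linearZ /= exprS -scaleN1r scalerA.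
by [].
Qed.

(** The sign [(-1)^(rj+t)] is used up: [(-1)^t] arises when the [t] twists of the block pass through
    [m j], and each of the [r] letters to its left yields [(-1)^j]. *)
Lemma comp_m_susp j n w : (0 < j <= n)%N -> size w = n ->
  comp_m m j n (fun x => phi (susp x)) (susp w) =
  coder kt (suspended m) (pred1 j) phi w.
Proof.
move=> /andP[j0 jn] wn; rewrite coder_pred1_sum ?j0 ?wn //.
rewrite /comp_m; apply: eq_big_nat => r /andP[_ rn].
set t := (n - j - r)%N.
set u := take r w; set b := take j (drop r w); set v := drop (r + j) w.
have wE : w = u ++ b ++ v.
  rewrite -{1}(cat_take_drop r w) -{1}(cat_take_drop j (drop r w)).
  by rewrite drop_drop addnC.
have su : size u = r by rewrite size_takel // wn; lia.
have sb : size b = j by rewrite size_takel // size_drop wn; lia.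
have sv : size v = t by rewrite size_drop wn /t; lia.
rewrite [in susp w]wE !susp_cat.
have := @tensor_block _ _ (mfac m j) idfun
  (map (iter (size (b ++ v)) kt) (susp u))
  (map (iter (size v) kt) (susp b)) (susp v).
rewrite !size_map !size_susp su sb sv => -> //; rewrite map_id /=.
rewrite susp_cat /= suspK size_susp sv size_cat sb sv.
rewrite m_iter_kt ?size_susp // iter_ktZ iter_ktK.
rewrite -[map _ (map _ _)]map_comp susp_map; last first.
  move=> x /=; rewrite !koszul_nat !iter_kt.
  by case: odd; case: odd; rewrite ?linearZ.
rewrite suspK -map_comp.
(* A letter of [u] is twisted [j + t] times in [susp w], [j + 2] times by the Koszul operator and
   [t + 1] times by the outer suspension. The total is odd, so one [kt] remains. *)
rewrite (eq_map (g := fun x => (-1) ^+ j *: kt x)); last first.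
  move=> x /=; rewrite koszul_nat -/(iter t.+1 kt _) iter_ktZ !iter_ktD.
  rewrite iter_kt (_ : odd _ = true); last lia.
  by rewrite -signr_odd oddD addbF signr_odd.
rewrite (map_comp ( *:%R ((-1) ^+ j)) kt) (mlin_scale_pref phi_mlin).
rewrite (mlinZ phi_mlin) !scalerA size_map su /suspended sb.
rewrite -[RHS]scale1r; congr (_ *: _).
rewrite -exprM -!exprD -signr_odd (_ : odd _ = false) //; lia.
Qed.

(** Each of the [r] letters before [h] gives a sign, as [koszul 1] is [- kt], and [h] anticommutes
    with the [t] twists of its argument; [r + t = n - 1] in every summand. *)
Lemma htpy_comp_h_susp (h g : {linear V -> V}) n w : size w = n ->
    (forall a, h (kt a) = - kt (h a)) -> (forall a, g (kt a) = kt (g a)) ->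
  \sum_(0 <= r < n) phi (susp (tensor
    (nseq r fid ++ unary 1 h :: nseq (n - 1 - r) (unary 0 g)) (susp w))) =
  (-1) ^+ n.-1 *: htpy kt h g phi w.
Proof.
move=> wn hk gk; rewrite htpy_nat scaler_sumr wn.
apply: eq_big_nat => r /andP[_ rn]; set t := (n - 1 - r)%N.
set u := take r w; set a := nth 0 w r; set v := drop r.+1 w.
have wE : w = u ++ [:: a] ++ v.
  by rewrite -{1}(cat_take_drop r w) (drop_nth 0) ?wn.
have su : size u = r by rewrite size_takel // wn ltnW.
have sv : size v = t by rewrite size_drop wn /t; lia.
rewrite [in susp w]wE !susp_cat.
have := @tensor_block _ _ (unary 1 h) g
  (map (iter (size ([:: a] ++ v)) kt) (susp u))
  (map (iter (size v) kt) (susp [:: a])) (susp v).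
rewrite !size_map !size_susp su sv => -> //.
rewrite susp_cat /= !size_map size_susp sv.
rewrite -[map _ (map _ _)]map_comp susp_map; last first.
  by move=> x; rewrite /= -iterSr /= !koszul1 [RHS]raddfN.
rewrite suspK -map_comp susp_map // suspK.
have hkt s x : h (iter s kt x) = (-1) ^+ s *: iter s kt (h x).
  elim: s => [|s IHs]; first by rewrite scale1r.
  by rewrite !iterS hk IHs [kt (_ *: _)]linearZ exprS -scalerA scaleN1r.
rewrite hkt iter_ktZ iter_ktK.
rewrite (eq_map (g := fun x => (-1) *: kt x)); last first.
  move=> x; transitivity (iter t.+1 kt (koszul 1 (iter t.+1 kt x))) => //.
  rewrite koszul1 -scaleN1r iter_ktZ -(iterS t.+1) iter_ktD iter_kt.
  by rewrite (_ : odd _ = true) //; lia.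
rewrite (map_comp ( *:%R (-1)) kt) (mlin_scale_pref phi_mlin).
rewrite (mlinZ phi_mlin) scalerA size_map su -exprD.
by have -> : (r + t = n.-1)%N by rewrite /t; lia.
Qed.

End Translation.

Arguments eq_comp_m {k V W m j n psi psi' w}.

(** * Compositions and the sign [l(i_1, ..., i_r)] *)

Section Blocks.
Variables (k : fieldType) (V H : graded k) (f : nat -> seq V -> H).
Local Notation q := (suspended f).

Fixpoint blocks (c : seq nat) (w : seq V) : seq H :=
  if c is x :: c' then q (take x w) :: blocks c' (drop x w) else [::].

Lemma lsign_cons x c :
  lsign (x :: c) = (lsign c + x * \sum_(y <- c) y.-1)%N.
Proof.
rewrite /lsign /= big_nat_recl // big_geq // add0n.
rewrite [X in (_ * X)%N](big_nth 0%N) big_distrr /= [RHS]addnC -big_split /=.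
by apply: eq_big_nat => b _; rewrite big_nat_recl //= [(x * _)%N]mulnC.
Qed.

Lemma sum_predn (c : seq nat) : all (leq 1) c ->
  (sumn c = \sum_(y <- c) y.-1 + size c)%N.
Proof.
elim: c => [|y c IHc] /=; first by rewrite big_nil.
by case/andP=> y0 c0; rewrite big_cons IHc //; lia.
Qed.

Lemma sum_dg (W : Type) (F : nat -> seq V -> W) (c : seq nat) : all (leq 1) c ->
  \sum_(g <- [seq Factor y (y%:Z - 1) (F y) | y <- c]) dg g =
  (\sum_(y <- c) y.-1)%N%:Z.
Proof.
elim: c => [|y c IHc] /=; first by rewrite !big_nil.
by case/andP=> y0 c0; rewrite !big_cons IHc //=; lia.
Qed.

Hypothesis f_graded : forall n, (0 < n)%N -> graded_map n (n%:Z - 1) (f n).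

(** After suspension every [f n] is even: the exponent [n + (n - 1) + 1] is. *)
Lemma f_iter_kt n t w : (0 < n)%N -> size w = n ->
  f n (map (iter t (@kt k V)) w) = iter t (@kt k H) (f n w).
Proof.
move=> n0 wn; elim: t => [|t IHt] /=; first by rewrite map_id.
rewrite map_comp (graded_map_kt (f_graded n0)) ?size_map // IHt.
rewrite exprS exprD (signz_nat _ n 1) -exprD addnA addnn.
by rewrite -signr_odd oddD odd_double expr1 mulrNN mulr1 scale1r.
Qed.

(** The first block, of length [x], takes the Koszul sign [(-1)^(x M)], which is its share of
    [lsign] by [lsign_cons]. Its twists number [size v + M + size c], which is even because
    [size v = M + size c]. *)
Lemma susp_tensor_blocks (W : lmodType k) (phi : seq H -> W) (c : seq nat) w :
    mlin phi -> all (leq 1) c -> sumn c = size w ->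
  (-1) ^+ lsign c *:
    phi (susp (tensor [seq Factor x (x%:Z - 1) (f x) | x <- c] (susp w))) =
  phi (blocks c w).
Proof.
elim: c w phi => [|x c IHc] w phi phiL.
  by rewrite /lsign big_geq // scale1r.
case/andP=> x0 c0 wE; set u := take x w; set v := drop x w.
have wuv : w = u ++ v by rewrite cat_take_drop.
have su : size u = x by rewrite size_takel // -wE leq_addr.
have sv : size v = sumn c by rewrite size_drop -wE addKn.
rewrite [in susp w]wuv susp_cat /= sum_dg //.
rewrite take_size_cat ?size_map ?size_susp //.
rewrite drop_size_cat ?size_map ?size_susp //.
set M := (\sum_(y <- c) y.-1)%N.
rewrite (eq_map (g := fun z => (-1) ^+ M *: iter M (@kt k V) z)); last first.
  by move=> z; rewrite koszul_kt absz_nat.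
rewrite (map_comp ( *:%R ((-1) ^+ M)) (iter M (@kt k V))).
(* [f x] is multilinear on words of length [x] only, so the scalars are extracted through its
   suspension, which is [mlin]. *)
have fZ b z : size z = x -> f x (map ( *:%R b) z) = b ^+ x *: f x z.
  move=> zx; have fL n : (0 < n)%N -> multilinear n (f n).
    by case/f_graded.
  have := mlin_scale_pref (suspended_mlin fL) b (susp z) [::].
  rewrite !cats0 /suspended size_map size_susp suspK zx susp_map; last first.
    by move=> a; rewrite linearZ.
  by rewrite suspK.
rewrite fZ ?size_map ?size_susp // f_iter_kt ?size_map ?size_susp //.
rewrite f_iter_kt ?size_susp // size_tensor size_map.
rewrite iter_ktZ !iter_ktD iter_kt (_ : odd _ = false); last first.
  by have := sum_predn c0; rewrite -/M -sv => ->; lia.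
rewrite (mlinZ phiL [::]) scalerA lsign_cons -/M exprD -mulrA -exprM -exprD.
rewrite mulnC addnn -[X in _ * X]signr_odd odd_double mulr1.
rewrite (IHc v (fun y => phi (f x (susp u) :: y))) //; last exact: mlin_cons.
by rewrite /suspended -/u su.
Qed.

(** The first part of a composition is the first cut made by [blockmap]. The bound [N] fixes the
    type of the parts and so stays put while the word shrinks in the induction. *)
Lemma sum_compositions (W : lmodType k) N r (phi : seq H -> W) w :
    (size w <= N)%N ->
  \sum_(c : r.-tuple 'I_N.+1 |
          all (fun x : 'I_N.+1 => 0 < x)%N c &&
          (\sum_(x <- c) (x : nat) == size w)%N) phi (blocks (map val c) w) =
  blockmap q r phi w.
Proof.
elim: r phi w => [|r IHr] phi w wN.
  case: w {wN} => [|a w] /=; last first.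
    by rewrite big_pred0 // => c; rewrite (tuple0 c) big_nil.
  rewrite (eq_bigl xpredT) => [|c]; last by rewrite (tuple0 c) big_nil.
  rewrite (eq_bigr (fun=> phi [::])) => [|c _]; last by rewrite (tuple0 c).
  by rewrite big_const card_tuple expn0 /= addr0.
rewrite blockmapS split_sum_nat.
rewrite (reindex
  (fun xc : 'I_N.+1 * r.-tuple 'I_N.+1 => [tuple of xc.1 :: xc.2])); last first.
  exists (fun c => (thead c, [tuple of behead c])) => [[x c] _|c _] /=.
    by congr (_, _); apply: val_inj.
  by rewrite -tuple_eta.
rewrite -(pair_big_dep xpredT (fun (x : 'I_N.+1) (c : r.-tuple 'I_N.+1) =>
   all (fun x : 'I_N.+1 => 0 < x)%N (x :: c) &&
          (\sum_(x <- x :: c) (x : nat) == size w)%N)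
   (fun x (c : r.-tuple 'I_N.+1) => phi (blocks (map val (x :: c)) w))) /=.
(* First parts outside this range begin no composition of [size w]. *)
transitivity (\sum_(x < N.+1) if (1 <= x < (size w).+1)%N then
    blockmap q r (fun y => phi (q (take x w) :: y)) (drop x w) else 0).
  apply: eq_bigr => x _; case: ifP => [/andP[x0 xw]|xw].
    rewrite -IHr ?size_drop; last by rewrite (leq_trans (leq_subr _ _)).
    apply: eq_bigl => c; rewrite x0 big_cons; congr (_ && _).
    by apply/eqP/eqP => /=; lia.
  apply: big_pred0 => c; apply/negP => /andP[/andP[x0 _] /eqP].
  rewrite big_cons => E; move: xw; rewrite x0 ltnS -E leq_addr //.
rewrite -big_mkcond -(big_mkord (fun x => 1 <= x < (size w).+1)%N (fun x =>
  blockmap q r (fun y => phi (q (take x w) :: y)) (drop x w))).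
rewrite [RHS](big_nat_widen _ _ N.+1) // [RHS](big_nat_widenl _ 0%N) //.
by apply: eq_bigl => x; rewrite andbC.
Qed.

End Blocks.

(** * Degrees in the tensor coalgebra of the suspension *)

Section SuspendedDegree.
Variables (k : fieldType) (V W : graded k).

Definition sdeg (e : seq int) : int := \sum_(x <- e) (x + 1).

Lemma sdeg_cons x e : sdeg (x :: e) = x + 1 + sdeg e.
Proof. exact: big_cons. Qed.

Lemma sdegE e : sdeg e = \sum_(x <- e) x + (size e)%:Z.
Proof.
elim: e => [|x e IHe]; first by rewrite /sdeg !big_nil.
by rewrite sdeg_cons big_cons IHe /=; lia.
Qed.

Definition has_sdeg (c : int) (phi : seq V -> W) : Prop :=
  forall e w, homs e w -> homog (sdeg e + c) (phi w).

Lemma has_sdeg_cons c phi x a : homog x a -> has_sdeg c phi ->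
  has_sdeg (c + x + 1) (fun y => phi (a :: y)).
Proof.
move=> xa phic e w ew; have := phic (x :: e) (a :: w) (conj xa ew).
by rewrite sdeg_cons; congr homog; lia.
Qed.

Lemma split_sum_homog c (G : seq V -> seq V -> W) e w :
    (forall e1 e2 u v, (0 < size u)%N -> homs e1 u -> homs e2 v ->
       homog (sdeg e1 + sdeg e2 + c) (G u v)) ->
  homs e w -> homog (sdeg e + c) (split_sum G w).
Proof.
elim: w e c G => [|a w IHw] [|x e] c G Gc //=; first by move=> _; apply: homog0.
case=> xa ew; apply: homogD.
  have := Gc [:: x] e [:: a] w isT (conj xa I) ew.
  by rewrite [sdeg [:: x]]sdeg_cons /sdeg big_nil addr0 big_cons.
have -> : sdeg (x :: e) + c = sdeg e + (c + x + 1) by rewrite sdeg_cons; lia.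
apply: IHw ew => e1 e2 u v u0 eu ev.
have := Gc (x :: e1) e2 (a :: u) v isT (conj xa eu) ev.
by rewrite sdeg_cons; congr homog; lia.
Qed.

Variables (mu : seq V -> V) (h g : V -> V).
Hypothesis mu_deg : forall e w, (0 < size w)%N -> homs e w ->
  homog (sdeg e - 2) (mu w).
Hypothesis h_deg : forall d v, homog d v -> homog (d + 1) (h v).
Hypothesis g_deg : forall d v, homog d v -> homog d (g v).

Lemma coder_has_sdeg P c phi :
  has_sdeg c phi -> has_sdeg (c - 1) (coder (@kt k V) mu P phi).
Proof.
move=> phic e w; elim: w e c phi phic => [|a w IHw] [|x e] c phi phic //.
  by move=> _; apply: homog0.
move=> [xa ew]; rewrite coder_cons; apply: homogD; last first.
  have := IHw _ _ _ (has_sdeg_cons (homog_kt xa) phic) ew.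
  by rewrite sdeg_cons; congr homog; lia.
apply: (split_sum_homog (e := x :: e) (w := a :: w) _ (conj xa ew)).
move=> e1 e2 u v u0 eu ev.
case: ifP => _; last exact: homog0.
have := phic (sdeg e1 - 2 :: e2) (mu u :: v) (conj (mu_deg u0 eu) ev).
by rewrite sdeg_cons; congr homog; lia.
Qed.

Lemma homs_map_g e w : homs e w -> homs e (map g w).
Proof.
by elim: e w => [|x e IHe] [|a w] //= [xa /IHe ew]; split=> //; apply: g_deg.
Qed.

Lemma htpy_has_sdeg c phi :
  has_sdeg c phi -> has_sdeg (c + 1) (htpy (@kt k V) h g phi).
Proof.
move=> phic e w; elim: w e c phi phic => [|a w IHw] [|x e] c phi phic //.
  by move=> _; apply: homog0.
move=> [xa ew]; rewrite htpy_cons; apply: homogD; last first.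
  have := IHw _ _ _ (has_sdeg_cons (homog_kt xa) phic) ew.
  by rewrite sdeg_cons; congr homog; lia.
have := phic (x + 1 :: e) (h a :: map g w) (conj (h_deg xa) (homs_map_g ew)).
by rewrite !sdeg_cons; congr homog; lia.
Qed.

End SuspendedDegree.

Lemma linear_kt (k : fieldType) (V W : graded k) (f : {linear V -> W}) c v :
    (forall d x, homog d x -> homog (d + c) (f x)) ->
  f (kt v) = (-1) ^+ `|c| *: kt (f v).
Proof.
move=> fc; pose F (w : seq V) := f (head 0 w).
have Fg : graded_map 1 c F.
  split=> [[|b l] [|b' r] a x y //= _|]; first by rewrite /F /= linearP.
  apply/has_degreeP => -[|x [|y e]] [|a [|b w]] //= _ [xa []].
  by rewrite big_seq1; apply: fc.
have := graded_map_kt Fg (w := [:: v]) erefl.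
by rewrite /F /= !exprS !mulN1r opprK.
Qed.

(** * The transferred maps of a deformation retract *)

Section Retract.
Variables (k : fieldType) (A : ainf k) (H : graded k).
Variables (p : {linear A -> H}) (i : {linear H -> A}) (h : {linear A -> A}).
Hypothesis retract :
  @deformation_retract k (ainf_complex A) (zero_complex H) p i h.

Local Notation m := (aop A).
Local Notation mu := (suspended (aop A)).
Local Notation K := (@kt k A).
Local Notation g := (i \o p).
Local Notation coder := (coder K mu).
Local Notation htpy := (htpy K h g).
Local Notation many := (fun j => 1 < j)%N.
Local Notation first1 := (first1 p).

Let m_graded n (n0 : (0 < n)%N) : graded_map n (n%:Z - 2) (m n).
Proof. exact: (aopP A).1. Qed.

Lemma mu_mlin : mlin mu.
Proof. by apply: suspended_mlin => n /m_graded[]. Qed.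

Lemma mu_kt w : (0 < size w)%N -> mu (map K w) = - K (mu w).
Proof.
move=> w0; rewrite /suspended size_map susp_map // (m_kt m_graded) //.
by rewrite size_susp.
Qed.

Lemma mu_deg e w : (0 < size w)%N -> homs e w -> homog (sdeg e - 2) (mu w).
Proof.
move=> w0 ew; have [_ /has_degreeP md] := m_graded w0.
have := md e (susp w) (size_susp w) (homs_susp ew).
by rewrite sdegE (homs_size ew); congr homog; lia.
Qed.

Lemma p_kt v : p (kt v) = kt (p v).
Proof.
rewrite (linear_kt (c := 0)) ?scale1r // => d x xd.
by rewrite addr0; apply: (p_deg retract).
Qed.

Lemma i_kt x : i (kt x) = kt (i x).
Proof.
rewrite (linear_kt (c := 0)) ?scale1r // => d y yd.
by rewrite addr0; apply: (i_deg retract).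
Qed.

Lemma h_kt v : h (kt v) = - kt (h v).
Proof.
by rewrite (linear_kt (c := 1)) ?scaleN1r //; apply: (h_deg retract).
Qed.

Lemma g_kt v : g (kt v) = kt (g v).
Proof. by rewrite /= p_kt i_kt. Qed.

Lemma eq_comp_h n (W : lmodType k) (phi phi' : seq A -> W) w :
    (forall y, size y = n -> phi y = phi' y) ->
  comp_h p i h n phi w = comp_h p i h n phi' w.
Proof.
move=> E; rewrite /comp_h; apply: eq_big_nat => r /andP[_ rn].
rewrite E // size_tensor size_cat /= !size_nseq; lia.
Qed.

Lemma comp_h_susp n (W : lmodType k) (phi : seq A -> W) w :
    mlin phi -> size w = n ->
  comp_h p i h n (fun y => phi (susp y)) (susp w) = (-1) ^+ n.-1 *: htpy phi w.
Proof.
move=> phiL wn; exact: (htpy_comp_h_susp (h := h) (g := g) phiL wn h_kt g_kt).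
Qed.

(* [q_approx N] agrees with the suspension of [transfer_p] on words of length
   at most [N], and is multilinear on all words. *)
Fixpoint q_approx (N : nat) (w : seq A) : H :=
  if N is N'.+1 then first1 w - htpy (coder many (q_approx N')) w else 0.

Lemma q_approxS N w :
  q_approx N.+1 w = first1 w - htpy (coder many (q_approx N)) w.
Proof. by []. Qed.

Lemma first1_mlin : mlin first1.
Proof.
apply: mlinP => -[|b [|b' l]] [|c r] a u v /=;
by rewrite ?linearP ?scaler0 ?addr0.
Qed.

Lemma q_approx_mlin N : mlin (q_approx N).
Proof.
elim: N => [|N IHN]; first by apply: mlinP => *; rewrite scaler0 addr0.
have dL := htpy_mlin K h g (coder_mlin K mu_mlin many IHN).
apply: mlinP => l r a u v.
by rewrite !q_approxS (mlinE first1_mlin) (mlinE dL) scalerBr opprD addrACA.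
Qed.

Lemma q_approx_deg N : has_sdeg (-1) (q_approx N).
Proof.
elim: N => [|N IHN] e w ew; first exact: homog0.
apply: homogD.
  case: w ew => [|a [|b w]] ew; try exact: homog0.
  case: e ew => [|x [|y e]] //= [xa []]; rewrite /sdeg big_seq1 addrK.
  exact: (p_deg retract).
apply: homogN.
apply: (htpy_has_sdeg (h_deg retract) (g := g) _ (coder_has_sdeg mu_deg _ IHN)).
  by move=> d v vd; apply: (i_deg retract); apply: (p_deg retract).
done.
Qed.

Lemma coder_many1 (W : lmodType k) (phi : seq A -> W) w :
  (size w <= 1)%N -> coder many phi w = 0.
Proof. by move=> w1; apply: coder0 => j y _ j1 jw; lia. Qed.

Lemma transfer_p_approx N n w : (n <= N)%N -> size w = n ->
  transfer_p p i h n (susp w) = q_approx N w.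
Proof.
elim: N n w => [|N IHN] n w nN wn.
  by move: nN wn; rewrite leqn0 => /eqP->; case: w.
case: n nN wn => [|[|n]] nN wn.
- by case: w wn => //= _; rewrite subr0.
- case: w wn => [|a [|b w]] // _.
  by rewrite q_approxS htpy_cons coder_many1 //= addr0 subr0.
set s := n.+2 in nN wn *; have s2 : (1 < s)%N by [].
have cL P := coder_mlin K mu_mlin P (q_approx_mlin N).
rewrite transfer_pE //.
have E j : (1 <= j < s)%N ->
    comp_h p i h s (comp_m m (s - j).+1 s (transfer_p p i h j)) (susp w) =
    (-1) ^+ s.-1 *: htpy (coder (pred1 (s - j).+1) (q_approx N)) w.
  case/andP=> j0 js; rewrite -comp_h_susp //; apply: eq_comp_h => y ys.
  rewrite -(comp_m_susp m_graded (q_approx_mlin N) (n := s)) ?size_susp //;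
    last lia.
  rewrite suspK; apply: eq_comp_m => z zs.
  rewrite -{1}[z]suspK IHN ?size_susp // ?zs; lia.
rewrite (eq_big_nat _ _ E) -scaler_sumr scalerA -exprD -htpy_sum.
(* The [(-1)^s] of the definition meets the [(-1)^(s-1)] of [comp_h_susp]. *)
rewrite (_ : (-1) ^+ _ = -1); last first.
  by rewrite -signr_odd (_ : odd _ = true) //; lia.
rewrite scaleN1r q_approxS (_ : first1 w = 0) ?sub0r; last first.
  by case: w wn {E} => [|? []].
congr (- _); apply: eq_htpy => y ys.
(* Reversal makes the summation index one less than the length of the contracted block, which runs
   from 2 to [s]. *)
rewrite big_nat_rev /=.
rewrite (eq_big_nat _ _ (F2 := fun j => coder (pred1 j.+1) (q_approx N) y));
  last first.
  move=> j /andP[j0 js]; congr (coder (pred1 _.+1) _ _); lia.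
transitivity (\sum_(2 <= j < s.+1) coder (pred1 j) (q_approx N) y).
  by rewrite [RHS]big_add1.
rewrite sum_coder_pred1 ?iota_uniq //; apply: eq_coder_pred => j j0 jy.
rewrite mem_index_iota; lia.
Qed.

Local Notation q := (suspended (transfer_p p i h)).

Lemma q_approxE N w : (size w <= N)%N -> q w = q_approx N w.
Proof. by move=> wN; apply: transfer_p_approx. Qed.

Lemma q_mlin : mlin q.
Proof.
apply: mlinP => l r a u v.
rewrite !(@q_approxE (size l + size r).+1) ?size_cat ?addnS //.
exact: mlinE (q_approx_mlin _) _ _ _ _ _.
Qed.

Lemma q_rec w : q w = first1 w - htpy (coder many q) w.
Proof.
rewrite (q_approxE (leqnSn _)) q_approxS; congr (_ - _).
apply: eq_htpy => y yw; apply: eq_coder => j z j0 j1 jy zy.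
by rewrite -q_approxE // -yw zy; lia.
Qed.

Lemma transfer_p_graded n : (0 < n)%N ->
  graded_map n (n%:Z - 1) (transfer_p p i h n).
Proof.
move=> n0; have qE w : size w = n -> transfer_p p i h n w = q (susp w).
  by move=> wn; rewrite /suspended suspK size_susp wn.
split=> [l r a u v lr|].
  have sz x : size (l ++ x :: r) = n by rewrite size_cat /= addnS.
  rewrite !qE // !susp_cat /= iter_ktP; exact: mlinE q_mlin _ _ _ _ _.
apply/has_degreeP => e w wn ew; rewrite qE // (q_approxE (leqnn _)).
have := q_approx_deg (size (susp w)) (homs_susp ew).
by rewrite sdegE (homs_size ew) wn; congr homog; lia.
Qed.

Lemma q_kt w : q (map K w) = kt (q w).
Proof.
case: w => [|a w]; first by rewrite /suspended /= raddf0.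
rewrite /suspended size_map susp_map //.
by rewrite (f_iter_kt transfer_p_graded 1) ?size_susp.
Qed.

Local Notation chi := (chi p i h).

(** Plays for [chi] the part that [q_approx] plays for [transfer_p]. *)
Fixpoint chi_approx (N : nat) (w : seq A) : A :=
  if N is N'.+1 then
    (if (1 < size w)%N then mu w else 0) - coder many (htpy (chi_approx N')) w
  else 0.

Lemma chi_approxS N w :
  chi_approx N.+1 w =
  (if (1 < size w)%N then mu w else 0) - coder many (htpy (chi_approx N)) w.
Proof. by []. Qed.

Lemma chi_approx_mlin N : mlin (chi_approx N).
Proof.
elim: N => [|N IHN]; first by apply: mlinP => *; rewrite scaler0 addr0.
have dL := coder_mlin K mu_mlin many
             (htpy_mlin K h g IHN).
apply: mlinP => l r a u v.
rewrite !chi_approxS (mlinE dL) scalerBr opprD addrACA; congr (_ + _).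
rewrite !size_cat /=; case: ifP => _; first exact: mlinE mu_mlin _ _ _ _ _.
by rewrite scaler0 addr0.
Qed.

Lemma chi_approxE N n w : (n <= N)%N -> size w = n ->
  chi n (susp w) = chi_approx N w.
Proof.
elim: N n w => [|N IHN] n w nN wn.
  by move: nN; rewrite leqn0 => /eqP->.
have [n1|n1] := leqP n 1.
  rewrite chi_approxS wn ltnNge n1 coder_many1 ?wn // subr0.
  by case: n n1 {nN wn} => [|[]].
have xL := htpy_mlin K h g (chi_approx_mlin N).
set phi := htpy (chi_approx N) in xL *.
rewrite chi_approxS wn n1 -/phi.
have -> : coder many phi w = \sum_(2 <= j < n) coder (pred1 j) phi w.
  transitivity (\sum_(2 <= j < n.+1) coder (pred1 j) phi w).
    rewrite sum_coder_pred1 ?iota_uniq //; apply: eq_coder_pred => j j0 jw.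
    by rewrite mem_index_iota ltnS -wn jw andbT.
  (* Contracting the whole word leaves one letter, on which [chi] has the default value 0; this is
     why the recursion for [chi] stops at [j = n - 2]. *)
  rewrite big_nat_recr //= [X in _ + X]coder0 ?addr0 // => j y _ /eqP -> _.
  rewrite wn subnn => y1; apply: htpy0 => z; rewrite y1 => z1.
  by rewrite -(IHN 1%N) //; lia.
have [n2|n2] := leqP n 2.
  have -> : n = 2%N by lia.
  by rewrite big_geq // subr0 /suspended wn (_ : n = 2%N) //; lia.
rewrite chiE // -sumrN; congr (_ + _); first by rewrite /suspended wn.
have -> : n = n.-1.+1 by lia.
rewrite [RHS]big_add1 /=; apply: eq_big_nat => j /andP[j0 jn].
have -> : n.-1.+1 = n by lia.
(* The sign from [comp_h_susp] on words of length [n - j]; with the [(-1)^(n-j)] of the definition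
   it gives [-1]. *)
pose c : k := (-1) ^+ (n - j).-1.
have cL : mlin (fun z => c *: phi z).
  by apply: mlinP => *; rewrite (mlinE xL) scalerDr !scalerA mulrC.
rewrite (eq_comp_m (psi' := fun y => c *: phi (susp y))); last first.
  move=> y yn; have {}yn : size y = (n - j)%N by rewrite yn; lia.
  rewrite -{1}[y]suspK.
  rewrite (eq_comp_h (phi' := fun z => chi_approx N (susp z))); last first.
    by move=> z zn; rewrite -{1}[z]suspK (IHN _ _ _ _) ?size_susp //; lia.
  by rewrite (comp_h_susp (chi_approx_mlin N)) ?size_susp.
rewrite (comp_m_susp m_graded cL) //; last lia.
rewrite coderZ scalerA /c -exprD (_ : (-1) ^+ _ = -1) ?scaleN1r //.
by rewrite -signr_odd (_ : odd _ = true) //; lia.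
Qed.

Lemma chi_rec w : suspended chi w =
  (if (1 < size w)%N then mu w else 0) - coder many (htpy (suspended chi)) w.
Proof.
rewrite {1}/suspended (chi_approxE (leqnSn _)) // chi_approxS; congr (_ - _).
apply: eq_coder => j y j0 j1 jw yj; apply: eq_htpy => z zy.
by rewrite /suspended (@chi_approxE (size w)) // zy yj; lia.
Qed.

Lemma p_m1 a : p (m1 a) = 0.
Proof. exact: (p_chain retract a). Qed.

Lemma m1_i x : m1 (i x) = 0.
Proof. by have /= <- := i_chain retract x; rewrite raddf0. Qed.

(** Both sides solve X = p delta - X H delta, the left by the recursion for chi and the right by the
    one for q. Since delta shortens words, induction on the length shows that they agree. *)
Lemma p_chi w : p (suspended chi w) = coder many q w.
Proof.
have dq v : coder many q v =
    (if (1 < size v)%N then p (mu v) else 0) -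
    coder many (htpy (coder many q)) v.
  have -> : (if (1 < size v)%N then p (mu v) else 0) = coder many first1 v.
    by rewrite coder_first1; case: v => [|? []].
  rewrite -coderN -coderD; apply: eq_coder => *; exact: q_rec.
move: {2}(size w) (leqnn (size w)) => N; elim: N w => [|N IHN] w wN.
  rewrite chi_rec dq !coder_many1 ?subr0; try by apply: leq_trans wN _.
  by rewrite ltnNge (leq_trans wN) // raddf0.
rewrite chi_rec dq raddfB /=; congr (_ - _).
  by case: ifP; rewrite ?raddf0.
rewrite (raddf_coder (L := p)) ?raddf0 //; last exact: raddfD.
apply: eq_coder => j y j0 j1 jw yj /=.
rewrite (raddf_htpy (L := p)) ?raddf0 //; last exact: raddfD.
by apply: eq_htpy => z zy /=; apply: IHN; rewrite zy yj; lia.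
Qed.

Local Notation mH := (suspended (transfer_m p i h)).

Lemma mH_map_p w : mH (map p w) = coder many q (map g w).
Proof.
rewrite /suspended size_map /transfer_m.
case: leqP => w1; first by rewrite coder_many1 ?size_map.
have -> : tensor (nseq (size w) (unary 0 i)) (susp (map p w)) =
    susp (map i (map p w)).
  rewrite [RHS]susp_map; last exact: i_kt.
  by rewrite -(size_map p w) -(size_susp (map p w)) tensor_unary0.
by rewrite -map_comp -p_chi /suspended size_map.
Qed.

Lemma mu_ainf w : coder predT mu w = 0.
Proof.
case: w => [//|a w]; set w' := a :: w.
have := (aopP A).2 (size w') (susp w') isT (size_susp w').
rewrite (eq_big_nat _ _ (F2 := fun s => coder (pred1 s) mu w'));
  last first.
  move=> s /andP[s0 sw].
  rewrite -(comp_m_susp m_graded mu_mlin (n := size w')) ?s0 //.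
  by apply: eq_comp_m => y ys; rewrite /suspended suspK size_susp ys.
rewrite sum_coder_pred1 ?iota_uniq // => E; rewrite -[RHS]E.
by apply: eq_coder_pred => j j0 jw; rewrite mem_index_iota j0 ltnS jw.
Qed.

Lemma transfer_p_morphism (m'_ainf : is_ainf (transfer_m p i h)) :
  is_ainf_morphism (A := A) (B := Ainf m'_ainf) (transfer_p p i h).
Proof.
split=> [n n0|n w n0 wn]; first exact: transfer_p_graded.
have mHL : mlin mH by apply: suspended_mlin => r /(m'_ainf.1)[].
(* Every word is a suspension, so both sides become functionals evaluated at [v]: q b on the left
   and m' F on the right. *)
rewrite -[w]suspK; set v := susp w; have vn : size v = n by rewrite size_susp.
transitivity (coder predT q v).
  rewrite (eq_big_nat _ _ (F2 := fun s => coder (pred1 s) q v)); last first.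
    move=> s /andP[s0 sn].
    rewrite -(comp_m_susp m_graded q_mlin (n := n)) ?s0 //.
    by apply: eq_comp_m => y ys; rewrite /suspended suspK size_susp ys.
  rewrite sum_coder_pred1 ?iota_uniq //; apply: eq_coder_pred => j j0 jw.
  by rewrite mem_index_iota j0 ltnS -vn jw.
have hh a : h (h a) = 0 by apply: (hh0 retract).
have ph a : p (h a) = 0 by apply: (ph0 retract).
have hg a : h (g a) = 0 by apply: (hi0 retract).
have gh a : g (h a) = 0 by rewrite /= ph raddf0.
have pg a : p (g a) = p a by apply: (piK retract).
have homotopy a : a - g a = mu [:: h a] + h (mu [:: a]).
  exact: (ip_homotopy retract).
have mu1_g a : mu [:: g a] = 0 by apply: m1_i.
have p_mu1 a : p (mu [:: a]) = 0 by apply: p_m1.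
have g_mu1 a : g (mu [:: a]) = 0 by rewrite /= p_m1 raddf0.
rewrite (transfer_morphism mu_mlin (@ktK _ _) hh hg gh ph pg q_mlin q_kt q_rec
  mu_kt homotopy mu1_g p_mu1 g_mu1 mu_ainf mHL mH_map_p (n := n)); last first.
  by rewrite vn n0 leqnn.
apply: eq_big_nat => r _.
(* The component of F with [r] blocks is expanded over compositions, and [susp_tensor_blocks]
   restores the sign [lsign] of each. *)
rewrite -(sum_compositions (transfer_p p i h) (N := n)) ?vn //.
apply: eq_bigr => c /andP[c0 /eqP cE].
have c0' : all (leq 1) (map val c) by rewrite all_map.
rewrite -(susp_tensor_blocks transfer_p_graded) //; last first.
  by rewrite vn sumnE big_map; exact: cE.
rewrite -map_comp /suspended size_susp size_tensor size_map size_tuple suspK.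
by [].
Qed.

End Retract.

Theorem theorem7p10 (k : fieldType) (A : ainf k)
    (p : {linear A -> homology (ainf_complex A)})
    (i : {linear homology (ainf_complex A) -> A})
    (h : {linear A -> A})
    (retract : @deformation_retract k (ainf_complex A)
                 (zero_complex (homology (ainf_complex A))) p i h)
    (m'_ainf : is_ainf (transfer_m p i h)) :
  is_ainf_morphism (A := A) (B := Ainf m'_ainf) (transfer_p p i h).
Proof. exact: transfer_p_morphism. Qed.
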